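(* Let $G$ be a three-dimensional (real) Lie group endowed with a left-invariant Riemannian metric $g$, and let $(\mathfrak{g},\langle\,,\rangle)$ be the corresponding metric Lie algebra. If $(G,g)$ can be locally isometrically embedded into the Euclidean space $\mathbb{R}^4$, then $(\mathfrak{g},\langle\,,\rangle)$ is isometric up to scaling to one of the following metric Lie algebras: \begin{itemize} \item the abelian Lie algebra $\mathbb{R}^3$ with any inner product; \item $\mathfrak{r}_{3,0}$, with basis $e_1,e_2,e_3$ whose only non-zero bracket relation is $[e_1,e_2]=e_2$, equipped with the inner product for which $\{e_1,e_2,e_3\}$ is orthonormal; \item $\mathfrak{r}'_{3,0}$, with basis $e_1,e_2,e_3$ whose non-zero bracket relations are $[e_1,e_2]=-e_3$, $[e_1,e_3]=e_2$, equipped with the inner product for which $\{e_1,e_2,e_3\}$ is orthonormal; \item $\mathfrak{so}(3)$, with basis $e_1,e_2,e_3$ whose bracket relations are $[e_1,e_2]=e_3$, $[e_2,e_3]=e_1$, $[e_3,e_1]=e_2$, equipped with the inner product for which $\{e_1,e_2,e_3\}$ is orthonormal. \end{itemize}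
   Context: The metric Lie algebra of $(G,g)$ is the pair $(\mathfrak{g},\langle\,,\rangle)$, where $\mathfrak{g}$ is the Lie algebra of $G$ and $\langle\,,\rangle$ is the inner product on $\mathfrak{g}$ given by $g$ at the unit element $e\in G$. ''$(G,g)$ can be locally isometrically embedded into $\mathbb{R}^4$'' means that there exist an open neighborhood $U$ of $e$ (the choice of point is immaterial by homogeneity) and a $C^\infty$ embedding $F:U\to\mathbb{R}^4$ such that $\langle dF,dF\rangle_{\mathbb{R}^4}=g$ on $U$. Two metric Lie algebras $(\mathfrak{g}_1,\langle\,,\rangle_1)$ and $(\mathfrak{g}_2,\langle\,,\rangle_2)$ are isometric up to scaling if there exist $k>0$ and a Lie algebra isomorphism $f:\mathfrak{g}_1\to\mathfrak{g}_2$ with $\langle\cdot,\cdot\rangle_1=k\langle f(\cdot),f(\cdot)\rangle_2$. *)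

(* Defs.v *)
From HB Require Import structures.
From mathcomp Require Import all_boot all_order all_algebra.
From mathcomp Require Import all_classical all_reals all_analysis.

Set Implicit Arguments.
Unset Strict Implicit.
Unset Printing Implicit Defensive.

Import Order.TTheory GRing.Theory Num.Theory.
Import numFieldNormedType.Exports.

Local Open Scope classical_set_scope.
Local Open Scope ring_scope.

(* On an open set A of a finite-dimensional space: f is C^(k+1) iff it is
   differentiable on A and each of its directional derivatives is C^k. *)
Fixpoint Ck_on (R : realType) (V W : normedModType R) (k : nat) (A : set V)
    (f : V -> W) : Prop :=
  if k is k'.+1 then
    (forall x, A x -> differentiable f x) /\
    (forall v : V, Ck_on k' A ('D_v f))
  else forall x, A x -> {for x, continuous f}.

Definition smooth_on (R : realType) (V W : normedModType R) (A : set V)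
  (f : V -> W) : Prop := forall k, Ck_on k A f.

(* The values of chart_map outside chart_dom, and of chart_inv outside
   chart_codom, are irrelevant. *)
Record chart (R : realType) (M : topologicalType) (n : nat) := Chart {
  chart_dom : set M;
  chart_map :> M -> 'rV[R]_n;
  chart_inv : 'rV[R]_n -> M;
  chart_dom_open : open chart_dom;
  chart_codom_open : open (chart_map @` chart_dom);
  chart_mapK : forall p, chart_dom p -> chart_inv (chart_map p) = p;
  chart_map_continuous : forall p, chart_dom p -> {for p, continuous chart_map};
  chart_inv_continuous : forall x, (chart_map @` chart_dom) x ->
    {for x, continuous chart_inv} }.

Definition chart_codom (R : realType) (M : topologicalType) (n : nat)
  (c : chart R M n) : set 'rV[R]_n := c @` chart_dom c.

(* The atlas need not be maximal.  The chart chart_at p around p is used to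
   identify the tangent space T_p M with 'rV[R]_n, see below. *)
Record smooth_structure (R : realType) (M : topologicalType) (n : nat) :=
  SmoothStructure {
  atlas : set (chart R M n);
  chart_at : M -> chart R M n;
  chart_at_atlas : forall p, atlas (chart_at p);
  chart_at_dom : forall p, chart_dom (chart_at p) p;
  transition_smooth : forall c d, atlas c -> atlas d ->
    smooth_on (c @` (chart_dom c `&` chart_dom d)) (d \o chart_inv c);
  manifold_hausdorff : hausdorff_space M;
  manifold_second_countable : @second_countable M }.

Section Tangent.
Context (R : realType) (M : topologicalType) (n : nat).
Variable S : smooth_structure R M n.

(* An element u of 'rV[R]_n stands for the tangent vector at p whose components
   in the chart chart_at S p are u. *)
Definition tangent_space of M := 'rV[R]_n.

(* The tangent vector at p whose components in the chart c are v. *)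
Definition tangent_of (c : chart R M n) (p : M) (v : 'rV[R]_n) :
    tangent_space p :=
  'd (chart_at S p \o chart_inv c) (c p) v.

(* Conversely, the components in the chart c of a tangent vector at p. *)
Definition components (c : chart R M n) (p : M) (u : tangent_space p) :
    'rV[R]_n :=
  'd (c \o chart_inv (chart_at S p)) (chart_at S p p) u.

Definition tangent_diff (W : normedModType R) (F : M -> W) (p : M)
    (u : tangent_space p) : W :=
  'd (F \o chart_inv (chart_at S p)) (chart_at S p p) u.

Definition tangent_map (f : M -> M) (p : M) (u : tangent_space p) :
    tangent_space (f p) :=
  'd (chart_at S (f p) \o f \o chart_inv (chart_at S p)) (chart_at S p p) u.

Definition field_in_chart (c : chart R M n) (X : forall p, tangent_space p) :
    'rV[R]_n -> 'rV[R]_n :=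
  fun x => components c (X (chart_inv c x)).

(* [X, Y]^i = X^j (d_j Y^i) - Y^j (d_j X^i), computed at p in the chart
   chart_at S p, in which the components of X p are X p itself. *)
Definition field_bracket (X Y : forall p, tangent_space p) (p : M) :
    tangent_space p :=
  let c := chart_at S p in
  'd (field_in_chart c Y) (c p) (X p) - 'd (field_in_chart c X) (c p) (Y p).

Definition smooth_map_on (W : normedModType R) (U : set M) (F : M -> W) :
    Prop :=
  forall c, atlas S c ->
    smooth_on (c @` (chart_dom c `&` U)) (F \o chart_inv c).

(* F is an injective immersion on U and a homeomorphism from U onto its image;
   U is meant to be open. *)
Definition smooth_embedding_on (m : nat) (U : set M) (F : M -> 'rV[R]_m) :
    Prop :=
  [/\ smooth_map_on U F,
      forall p q, U p -> U q -> F p = F q -> p = q,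
      forall p, U p -> injective (@tangent_diff _ F p) &
      forall V, open V -> V `<=` U ->
        exists2 O : set 'rV[R]_m, open O & F @` V = F @` U `&` O].

(* {dot _ for idfun}: symmetric positive definite bilinear forms. *)
Record riemannian_metric := RiemannianMetric {
  metric_at :> forall p : M, {dot tangent_space p for idfun};
  metric_smooth : forall c, atlas S c -> forall v w : 'rV[R]_n,
    smooth_on (chart_codom c)
      (fun x => metric_at (chart_inv c x)
                  (tangent_of c (chart_inv c x) v)
                  (tangent_of c (chart_inv c x) w) : R^o) }.

End Tangent.

Section Euclid.
Context (R : realType) (n : nat).
Implicit Types u v w : 'rV[R]_n.

Definition euclid u v : R := \sum_(i < n) u 0 i * v 0 i.

Fact euclid_linearl v : linear_for *%R (euclid^~ v).
Proof.
move=> a u w; rewrite /euclid mulr_sumr -big_split /=.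
by apply: eq_bigr => i _; rewrite !mxE mulrDl mulrA.
Qed.

Fact euclid_sym u v : euclid u v = (-1) ^+ false * idfun (euclid v u).
Proof. by rewrite expr0 mul1r; apply: eq_bigr => i _; rewrite mulrC. Qed.

Fact euclid_linearr u : linear_for (idfun \; *%R) (euclid u).
Proof.
move=> a v w; have sym x : euclid u x = euclid x u by rewrite euclid_sym mul1r.
by rewrite !sym euclid_linearl.
Qed.

Fact euclid_gt0 u : u != 0 -> 0 < euclid u u.
Proof.
move=> u0; rewrite lt_neqAle eq_sym; apply/andP; split; last first.
  by apply: sumr_ge0 => i _; rewrite -expr2 sqr_ge0.
apply: contra u0; rewrite psumr_eq0; last by move=> i _; rewrite -expr2 sqr_ge0.
move=> /allP h; apply/eqP/rowP => i; rewrite mxE.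
by have := h i (mem_index_enum i); rewrite -expr2 sqrf_eq0 => /eqP.
Qed.

HB.instance Definition _ :=
  bilinear_isBilinear.Build R _ _ R *%R (idfun \; *%R) euclid
    (euclid_linearl, euclid_linearr).
HB.instance Definition _ :=
  isHermitianSesquilinear.Build R _ false idfun euclid euclid_sym.
HB.instance Definition _ := isDotProduct.Build R _ euclid euclid_gt0.

End Euclid.

(* Only the data of a metric Lie algebra: bilinearity of the bracket,
   alternation and the Jacobi identity are not recorded, since isometry up to
   scaling does not involve them. *)
Record metric_lie_algebra (R : realType) := MetricLieAlgebra {
  mla_space :> lmodType R;
  mla_bracket : mla_space -> mla_space -> mla_space;
  mla_ip : {dot mla_space for idfun} }.

Definition isometric_up_to_scaling (R : realType)
    (L1 L2 : metric_lie_algebra R) : Prop :=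
  exists (k : R) (f : {linear L1 -> L2}),
    [/\ 0 < k, bijective f,
        forall x y, f (mla_bracket x y) = mla_bracket (f x) (f y) &
        forall x y, mla_ip L1 x y = k * mla_ip L2 (f x) (f y)].

Section Models.
Context (R : realType).
Local Notation V := 'rV[R]_3.

Definition e1 : V := 'e_0.
Definition e2 : V := 'e_1.
Definition e3 : V := 'e_2%:R.

(* The alternating bilinear bracket on R^3 with
   [e1, e2] = b12, [e2, e3] = b23 and [e3, e1] = b31. *)
Definition bracket3 (b12 b23 b31 u v : V) : V :=
  (u 0 0 * v 0 1 - u 0 1 * v 0 0) *: b12
  + (u 0 1 * v 0 2%:R - u 0 2%:R * v 0 1) *: b23
  + (u 0 2%:R * v 0 0 - u 0 0 * v 0 2%:R) *: b31.

Definition abelian3 (ip : {dot V for idfun}) : metric_lie_algebra R :=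
  @MetricLieAlgebra R V (fun _ _ => 0) ip.

Definition euclid3 : {dot V for idfun} := @euclid R 3.

Definition r3_0 : metric_lie_algebra R :=
  @MetricLieAlgebra R V (bracket3 e2 0 0) euclid3.

(* [e3, e1] = - e2 *)
Definition r'3_0 : metric_lie_algebra R :=
  @MetricLieAlgebra R V (bracket3 (- e3) 0 (- e2)) euclid3.

Definition so3 : metric_lie_algebra R :=
  @MetricLieAlgebra R V (bracket3 e3 e1 e2) euclid3.

End Models.

HB.mixin Record isTopologicalGroup G & Group G & Topological G := {
  mulg_continuous : continuous (fun x : G * G => (x.1 * x.2)%g);
  invg_continuous : continuous (fun x : G => x^-1%g) }.

#[short(type="topGroupType")]
HB.structure Definition TopologicalGroup :=
  {G of isTopologicalGroup G & Group G & Topological G}.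

Record lie_group (R : realType) (n : nat) := LieGroup {
  lg_group :> topGroupType;
  lg_structure :> smooth_structure R lg_group n;
  lg_mul_smooth : forall c1 c2 d,
    atlas lg_structure c1 -> atlas lg_structure c2 -> atlas lg_structure d ->
    smooth_on
      [set z : 'rV[R]_n * 'rV[R]_n | chart_codom c1 z.1 /\ chart_codom c2 z.2 /\
         chart_dom d (chart_inv c1 z.1 * chart_inv c2 z.2)%g]
      (fun z => d (chart_inv c1 z.1 * chart_inv c2 z.2)%g);
  lg_inv_smooth : forall c d,
    atlas lg_structure c -> atlas lg_structure d ->
    smooth_on
      [set x : 'rV[R]_n | chart_codom c x /\ chart_dom d (chart_inv c x)^-1%g]
      (fun x => d (chart_inv c x)^-1%g) }.

Section LieGroup.
Context (R : realType) (n : nat).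
Variable G : lie_group R n.

Definition left_translation (a : G) : G -> G := fun p => (a * p)%g.

(* The left-invariant vector field with value v at the unit. *)
Definition left_invariant_field (v : tangent_space R n (1%g : G)) :
    forall p : G, tangent_space R n p :=
  fun p => tangent_map G (left_translation p) (p := 1%g) v.

(* The Lie algebra of G is the tangent space at the unit, identified with the
   space of left-invariant vector fields. *)
Definition lie_algebra_bracket (v w : tangent_space R n (1%g : G)) :
    tangent_space R n (1%g : G) :=
  field_bracket G (left_invariant_field v) (left_invariant_field w) 1%g.

Definition left_invariant (g : riemannian_metric G) : Prop :=
  forall (a p : G) (u v : tangent_space R n p),
    g (a * p)%g (tangent_map G (left_translation a) u)
                (tangent_map G (left_translation a) v)
    = g p u v.

Definition metric_lie_algebra_of (g : riemannian_metric G) :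
    metric_lie_algebra R :=
  @MetricLieAlgebra R (tangent_space R n (1%g : G)) lie_algebra_bracket (g 1%g).

Definition locally_isometrically_embeddable (g : riemannian_metric G)
    (m : nat) : Prop :=
  exists (U : set G) (F : G -> 'rV[R]_m),
    [/\ open U, U 1%g, smooth_embedding_on G U F &
        forall p (u v : tangent_space R n p), U p ->
          euclid (tangent_diff G F u) (tangent_diff G F v) = g p u v].

End LieGroup.

(* Main.v *)
(* A left-invariant orthonormal frame e_i has constant Christoffel symbols, and
   its image under the embedding F, completed by the unit normal, is a moving
   frame of R^4.  The symmetric second fundamental form h, with functions as
   coefficients, satisfies the Gauss equation R = h /\ h, whose left-hand side is
   constant, and the Codazzi equations.  Choose the frame so that
   h = diag(a1, a2, a3) at the unit.
   - If a1 a2 a3 <> 0, differentiating the Gauss equation gives dh = 0 at the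
     unit; the Codazzi equations become algebraic and force a1 = a2 = a3, so the
     metric has constant positive curvature and the algebra is so(3).
   - If exactly a3 = 0, differentiating the Gauss equation and Codazzi show that
     the connection matrix has p31 = p32 = 0 and p12 = p21; the Gauss equation
     then gives r_{3,0}.
   - If h has rank at most 1, the metric is flat, and the algebra is abelian or
     r'_{3,0}.
   In a chart at the unit with multiplication m, the left-invariant fields are
   x |-> D_2 m(x, 1) w; that they are closed under brackets follows from
   associativity and the symmetry of second derivatives. *)
Require Import Defs.
From HB Require Import structures.
From mathcomp Require Import all_boot all_order all_algebra.
From mathcomp Require Import all_classical all_reals all_analysis.
From mathcomp Require Import ring lra.

Set Implicit Arguments.
Unset Strict Implicit.
Unset Printing Implicit Defensive.

Import Order.TTheory GRing.Theory Num.Theory.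
Import numFieldNormedType.Exports.

Local Open Scope classical_set_scope.
Local Open Scope ring_scope.

(** * Differential calculus on open sets *)

Section Calculus.
Context {R : realType}.
Implicit Types V W : normedModType R.

(** A frame that diagonalizes h at the unit need not do so nearby, and eigenvectors cannot be
    followed smoothly where eigenvalues collide. So h and its first derivatives are evaluated at the
    unit only, and the case analysis is algebra in these numbers and the structure constants. The
    Gauss equation prescribes the 2x2 minors of h; at rank 3 the linearization of h |-> h /\ h is
    injective, which is why differentiating it determines dh. All nine components of the Gauss
    equation are kept: their antisymmetric part is the first Bianchi identity, which for a
    torsion-free connection with constant coefficients is the Jacobi identity. Geometrically, the
    model on r_{3,0} is the product of a hyperbolic plane and a line, the one on r'_{3,0} is flat,
    and the one on so(3) is a round sphere. *)

Lemma near_eq_differentiable V W (f g : V -> W) (x : V) :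
  (\near x, f x = g x) -> differentiable f x -> differentiable g x.
Proof.
move=> fg df; have fgx : f x = g x := nbhs_singleton fg.
have dg : g \o shift x = cst (g x) + 'd f x +o_ 0 id.
  apply/eqaddoP => e e0.
  have /eqaddoP/(_ e e0) dfe := diff_locally df.
  have fg0 : \forall h \near (0 : V), f (h + x) = g (h + x).
    by move: fg; rewrite (near_shift 0)/= subr0.
  by apply: filterS2 dfe fg0 => h; rewrite !fctE /= => + <-; rewrite -fgx.
have cf := diff_continuous df.
by apply/diff_locallyP; rewrite (diff_unique cf dg).
Qed.

Lemma Ck_on_eq V W k (A : set V) (f g : V -> W) :
  open A -> (forall x, A x -> f x = g x) -> Ck_on k A f -> Ck_on k A g.
Proof.
move=> oA; elim: k f g => [|k IH] f g fg /=.
  move=> cf x Ax; rewrite /prop_for /continuous_at -(fg x Ax).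
  apply: cvg_trans (cf x Ax); apply: near_eq_cvg.
  by near=> y; apply: fg; near: y; exact: open_nbhs_nbhs.
move=> [df Dkf]; split=> [x Ax|v].
  apply: near_eq_differentiable (df x Ax).
  by near=> y; apply: fg; near: y; exact: open_nbhs_nbhs.
apply: IH (Dkf v) => x Ax; apply: near_eq_derive.
by near=> y; apply: fg; near: y; exact: open_nbhs_nbhs.
Unshelve. all: by end_near. Qed.

Lemma smooth_on_eq V W (A : set V) (f g : V -> W) :
  open A -> (forall x, A x -> f x = g x) -> smooth_on A f -> smooth_on A g.
Proof. by move=> oA fg sf k; exact: Ck_on_eq (sf k). Qed.

Lemma Ck_on_pred V W k (A : set V) (f : V -> W) : Ck_on k.+1 A f -> Ck_on k A f.
Proof.
elim: k f => [|k IH] f.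
  by move=> [df _] x Ax; apply/differentiable_continuous/df.
by move=> [df Df]; split=> // v; apply/IH/Df.
Qed.

Lemma Ck_on_sub V W k (A B : set V) (f : V -> W) :
  A `<=` B -> Ck_on k B f -> Ck_on k A f.
Proof.
move=> AB; elim: k f => [|k IH] f /=; first by move=> cf x /AB; exact: cf.
by move=> [df Df]; split=> [x /AB|v]; [exact: df|exact/IH/Df].
Qed.

Lemma smooth_on_sub V W (A B : set V) (f : V -> W) :
  A `<=` B -> smooth_on B f -> smooth_on A f.
Proof. by move=> AB sf k; exact: Ck_on_sub (sf k). Qed.

Lemma smooth_on_differentiable V W (A : set V) (f : V -> W) x :
  smooth_on A f -> A x -> differentiable f x.
Proof. by move=> /(_ 1%N) [df _]; exact: df. Qed.

Lemma smooth_on_derive V W (A : set V) (f : V -> W) (v : V) :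
  smooth_on A f -> smooth_on A ('D_v f).
Proof. by move=> sf k; have [_] := sf k.+1; exact. Qed.

Lemma smooth_on_cst V W (A : set V) (a : W) : smooth_on A (cst a : V -> W).
Proof.
move=> k; elim: k a => [|k IH] a /=.
  by move=> x _; exact: cst_continuous.
split=> [x _|v]; first exact: differentiable_cst.
have -> : 'D_v (cst a) = cst 0 :> (V -> W) by apply/funext => x; exact: derive_cst.
exact: IH.
Qed.


Lemma Ck_onD V W k (A : set V) (f g : V -> W) :
  open A -> Ck_on k A f -> Ck_on k A g -> Ck_on k A (fun x => f x + g x).
Proof.
move=> oA; elim: k f g => [|k IH] f g /=.
  by move=> cf cg x Ax; apply: cvgD; [exact: cf|exact: cg].
move=> [df Df] [dg Dg]; split=> [x Ax|v].
  by apply: differentiableD; [exact: df|exact: dg].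
apply: (Ck_on_eq (f := fun x => 'D_v f x + 'D_v g x)) => // [x Ax|]; last exact: IH.
by rewrite deriveD//; apply: diff_derivable; [exact: df|exact: dg].
Qed.

Lemma Ck_onM V k (A : set V) (f g : V -> R^o) :
  open A -> Ck_on k A f -> Ck_on k A g ->
  Ck_on k A (fun x => f x * g x : R^o).
Proof.
move=> oA; elim: k f g => [|k IH] f g.
  by move=> cf cg x Ax; apply: cvgM; [exact: cf|exact: cg].
move=> cf cg; have [df Df] := cf; have [dg Dg] := cg; split=> [x Ax|v].
  by apply: differentiableM; [exact: df|exact: dg].
apply: (Ck_on_eq (f := fun x => f x * 'D_v g x + g x * 'D_v f x)) => // [x Ax|].
  have -> : (fun x => f x * g x) = (f : V -> R) * g by [].
  by rewrite deriveM//; apply: diff_derivable; [exact: df|exact: dg].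
by apply: Ck_onD => //; apply: IH; [exact: Ck_on_pred|exact: Dg|exact: Ck_on_pred|exact: Df].
Qed.

Lemma smooth_onD V W (A : set V) (f g : V -> W) :
  open A -> smooth_on A f -> smooth_on A g -> smooth_on A (fun x => f x + g x).
Proof. by move=> oA sf sg k; exact: Ck_onD. Qed.

Lemma smooth_onM V (A : set V) (f g : V -> R^o) :
  open A -> smooth_on A f -> smooth_on A g ->
  smooth_on A (fun x => f x * g x : R^o).
Proof. by move=> oA sf sg k; exact: Ck_onM. Qed.

Lemma smooth_on_sum V W (A : set V) (I : Type) (r : seq I) (f : I -> V -> W) :
  open A -> (forall i, smooth_on A (f i)) ->
  smooth_on A (fun x => \sum_(i <- r) f i x).
Proof.
move=> oA sf; elim: r => [|i r IH].
  by apply: (smooth_on_eq (f := cst 0)) => // [x _|]; [rewrite big_nil|exact: smooth_on_cst].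
apply: (smooth_on_eq (f := fun x => f i x + \sum_(i <- r) f i x)) => // [x _|].
  by rewrite big_cons.
exact: smooth_onD.
Qed.

Lemma derive_coord V n (f : V -> 'rV[R]_n) x v i :
  derivable f x v -> 'D_v (fun y => f y 0 i : R^o) x = ('D_v f x) 0 i.
Proof. by move=> df; rewrite (derive_mx df) mxE. Qed.

Lemma smooth_on_coord V n (A : set V) (f : V -> 'rV[R]_n) i :
  open A -> smooth_on A f -> smooth_on A (fun x => f x 0 i : R^o).
Proof.
move=> oA sf k; elim: k f sf => [|k IH] f sf /=.
  move=> x Ax; apply: (@continuous_comp _ _ _ f (fun M : 'rV[R]_n => M 0 i)).
    exact: (sf 0%N).
  exact: coord_continuous.
split=> [x Ax|v].
  have := smooth_on_differentiable sf Ax => dfx.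
  exact: (differentiable_comp dfx (differentiable_coord _ _ _)).
apply: (Ck_on_eq (f := fun x => 'D_v f x 0 i)) => // [x Ax|].
  rewrite derive_coord//; apply: diff_derivable.
  exact: smooth_on_differentiable sf Ax.
by apply: IH; exact: smooth_on_derive.
Qed.

(* The difference quotients of [f \o phi] along [v] and of [f] along [w] are equal. *)
Lemma derive_comp_affine V1 V W (phi : V1 -> V) (f : V -> W) (v : V1) (w : V) x :
  (forall h : R, phi (h *: v + x) = h *: w + phi x) ->
  'D_v (f \o phi) x = 'D_w f (phi x).
Proof. by move=> phiE; rewrite /derive; under eq_fun do rewrite /= phiE. Qed.

(** For affine [phi], a directional derivative of [f \o phi] is a directional derivative of [f]
    composed with [phi], so the induction on the order of differentiability closes. It serves to
    restrict a product of two variables to slices. *)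
Lemma smooth_on_comp_affine V1 V W (A : set V) (phi : V1 -> V) (dphi : V1 -> V)
    (f : V -> W) :
  (forall x, differentiable phi x) ->
  (forall x v (h : R), phi (h *: v + x) = h *: dphi v + phi x) ->
  smooth_on A f -> smooth_on (phi @^-1` A) (f \o phi).
Proof.
move=> dfphi phiE sf k; elim: k f sf => [|k IH] f sf.
  move=> x Ax; apply: continuous_comp; last exact: (sf 0%N _ Ax).
  exact: differentiable_continuous.
split=> [x Ax|v].
  apply: differentiable_comp => //; exact: smooth_on_differentiable sf Ax.
have -> : 'D_v (f \o phi) = 'D_(dphi v) f \o phi.
  by apply/funext => x; exact: derive_comp_affine.
by apply: IH; exact: smooth_on_derive.
Qed.

Lemma derive_row_basis n W (f : 'rV[R]_n -> W) x (v : 'rV[R]_n) :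
  differentiable f x -> 'D_v f x = \sum_i v 0 i *: 'D_('e_i) f x.
Proof.
move=> df; rewrite deriveE// [v in LHS]row_sum_delta linear_sum.
by apply: eq_bigr => i _; rewrite linearZ -deriveE.
Qed.


Lemma differentiable_line V (u z : V) (t : R) :
  differentiable (fun t : R^o => t *: u + z) (t : R^o).
Proof. by apply: differentiableD => //; exact: differentiableZl. Qed.

Lemma is_derive_line V (f : V -> R^o) (u z : V) (t : R) :
  differentiable f (t *: u + z) ->
  is_derive t (1 : R) (fun t : R => f (t *: u + z)) ('D_u f (t *: u + z)).
Proof.
move=> df; pose phi := fun t : R^o => t *: u + z.
apply: DeriveDef.
  by apply: (@diff_derivable _ _ _ (f \o phi)); apply: differentiable_comp;
    [exact: differentiable_line|exact: df].
apply: (@derive_comp_affine _ _ _ phi f _ u) => h.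
by rewrite /phi -[h *: 1]/(h * 1) mulr1 scalerDl addrA.
Qed.

Lemma mean_value_line V (f : V -> R^o) (u z : V) (s : R) : 0 < s ->
  (forall t, 0 <= t <= s -> differentiable f (t *: u + z)) ->
  exists2 t, 0 <= t <= s & f (s *: u + z) - f z = 'D_u f (t *: u + z) * s.
Proof.
move=> s0 df.
have [|t||t ts] := @MVT R (fun t => f (t *: u + z)) (fun t => 'D_u f (t *: u + z)) 0 s.
- exact: s0.
- by rewrite in_itv/= => /andP[t0 ts]; apply/is_derive_line/df; rewrite !ltW.
- apply: derivable_within_continuous => t; rewrite in_itv/= => ts.
  by have [] := is_derive_line (df _ ts).
rewrite subr0 scale0r add0r => E; exists t => //.
by move: ts; rewrite in_itv/= => /andP[t0 ts]; rewrite !ltW.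
Qed.

(** The mean value theorem is applied along [u] to the increment z |-> f (s v + z) - f z, and then
    along [v] to ['D_u f]. *)
Lemma double_difference V (A : set V) (f : V -> R^o) (u v x : V) (s : R) :
  0 < s -> (forall t r, 0 <= t <= s -> 0 <= r <= s -> A (r *: v + (t *: u + x))) ->
  Ck_on 2 A f ->
  exists t r, [/\ 0 <= t <= s, 0 <= r <= s &
    f (s *: v + (s *: u + x)) - f (s *: u + x) - (f (s *: v + x) - f x)
    = 'D_v ('D_u f) (r *: v + (t *: u + x)) * s * s].
Proof.
move=> s0 As [df Df]; have s00 : (0 : R) <= 0 <= s by rewrite lexx ltW.
have ss : 0 <= s <= s by rewrite lexx ltW.
pose F z : R^o := f (s *: v + z) - f z.
have [t ts E1] : exists2 t, 0 <= t <= s & F (s *: u + x) - F x = 'D_u F (t *: u + x) * s.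
  apply: mean_value_line => // t ts; apply: differentiableB.
    apply: (@differentiable_comp _ _ _ _ (fun z => s *: v + z) f) => //.
    by apply: df; apply: As.
  by apply: df; have := As _ _ ts s00; rewrite scale0r add0r.
have DF : 'D_u F (t *: u + x) = 'D_u f (s *: v + (t *: u + x)) - 'D_u f (t *: u + x).
  rewrite deriveB.
  - congr (_ - _).
    by apply: (@derive_comp_affine _ _ _ (fun z => s *: v + z) f) => h; rewrite addrCA.
  - apply: diff_derivable; apply: (@differentiable_comp _ _ _ _ (fun z => s *: v + z) f) => //.
    by apply: df; apply: As.
  - by apply: diff_derivable; apply: df; have := As _ _ ts s00; rewrite scale0r add0r.
have [dDf _] := Df u.
have [r rs E2] := @mean_value_line _ ('D_u f) v (t *: u + x) s s0 (fun r rs => dDf _ (As _ _ ts rs)).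
by exists t, r; split=> //; rewrite -/(F _) -/(F _) E1 DF E2.
Qed.

Lemma dist_le_half (a b c e : R) :
  `|a - c| <= e / 2 -> `|b - c| <= e / 2 -> `|a - b| <= e.
Proof.
move=> ac bc; rewrite -(subrKA c) (splitr e) (le_trans (ler_normD _ _))//.
by rewrite lerD// distrC.
Qed.

(* The same second difference is a mixed derivative, in either order, at points
   arbitrarily close to [x]. *)
Lemma schwarz V (A : set V) (f : V -> R^o) (u v x : V) :
  open A -> A x -> Ck_on 2 A f -> 'D_u ('D_v f) x = 'D_v ('D_u f) x.
Proof.
move=> oA Ax C2.
have cuv : {for x, continuous ('D_u ('D_v f))}.
  have [_ D1] := C2; have [_ D2] := D1 v; exact: (D2 u x Ax).
have cvu : {for x, continuous ('D_v ('D_u f))}.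
  have [_ D1] := C2; have [_ D2] := D1 u; exact: (D2 v x Ax).
apply/eqP; rewrite -subr_eq0 -normr_le0; apply/ler_addgt0Pr => e e0; rewrite add0r.
have e20 : 0 < e / 2 by rewrite divr_gt0.
have nuv := (cvgrPdist_le _ _).1 cuv _ e20.
have nvu := (cvgrPdist_le _ _).1 cvu _ e20.
have [d /= d0 dB] := (nbhs_ballP _ _).1 (filterI (filterI (nuv _) (nvu _)) (open_nbhs_nbhs (conj oA Ax))).
(* With this side the parallelogram spanned by [s *: u] and [s *: v] stays in the ball; the summand
   1 covers u = v = 0. *)
pose s := d / (`|u| + `|v| + 1).
have n0 : 0 < `|u| + `|v| + 1 by rewrite ltr_wpDl ?addr_ge0.
have s0 : 0 < s by rewrite divr_gt0.
have inB t r : 0 <= t <= s -> 0 <= r <= s -> ball x d (r *: v + (t *: u + x)).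
  move=> /andP[t0 ts] /andP[r0 rs]; rewrite -ball_normE /= addrA [_ + x]addrC opprD addrA subrr add0r normrN.
  rewrite (le_lt_trans (ler_normD _ _))// !normrZ !ger0_norm//.
  rewrite (@le_lt_trans _ _ (s * (`|u| + `|v|)))//.
    by rewrite addrC mulrDr lerD// ler_wpM2r.
  by rewrite /s mulrAC -mulrA gtr_pMr// ltr_pdivrMr// mul1r ltrDl.
have As t r : 0 <= t <= s -> 0 <= r <= s -> A (r *: v + (t *: u + x)).
  by move=> ts rs; have /dB[] := inB _ _ ts rs.
have [t1 [r1 [t1s r1s E1]]] := double_difference s0 As C2.
have As' t r : 0 <= t <= s -> 0 <= r <= s -> A (r *: u + (t *: v + x)).
  by move=> ts rs; rewrite addrCA; exact: As.
have [t2 [r2 [t2s r2s E2]]] := double_difference s0 As' C2.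
have s00 : s != 0 by rewrite gt_eqF.
have E : 'D_v ('D_u f) (r1 *: v + (t1 *: u + x)) = 'D_u ('D_v f) (r2 *: u + (t2 *: v + x)).
  apply: (mulIf s00); apply: (mulIf s00).
  apply: etrans (esym E1) (etrans _ E2).
  rewrite [s *: u + (s *: v + x)]addrCA; move: (f _) (f _) (f _) (f _) => a b c d'.
  by rewrite !opprB addrACA [RHS]addrACA [- b - c]addrC.
have [[_ n1] _] := dB _ (inB _ _ t1s r1s).
have := inB _ _ r2s t2s; rewrite addrCA => /dB [[n2 _] _].
exact: dist_le_half n2 (eq_ind _ (fun z => `|_ - z| <= _) n1 _ E).
Qed.

End Calculus.

Lemma derive_dir_linear (R : realType) (V W : normedModType R) (f : V -> W) x a u v :
  differentiable f x -> 'D_(a *: u + v) f x = a *: 'D_u f x + 'D_v f x.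
Proof. by move=> df; rewrite !(deriveE _ df) linearP. Qed.

Lemma derive_dirB (R : realType) (V W : normedModType R) (f : V -> W) x u v :
  differentiable f x -> 'D_(u - v) f x = 'D_u f x - 'D_v f x.
Proof. by move=> df; rewrite !(deriveE _ df) linearB. Qed.

Lemma derive_linear_comb (R : realType) (V W : normedModType R) (f h : V -> W) x v (a : R) :
  derivable f x v -> derivable h x v ->
  'D_v (fun y => a *: f y + h y) x = a *: 'D_v f x + 'D_v h x.
Proof.
move=> df dh; have -> : (fun y => a *: f y + h y) = (a *: f) + h by [].
by rewrite deriveD ?deriveZ//; exact: derivableZ.
Qed.

Lemma derive_comp_diff (R : realType) (V1 V2 W : normedModType R) (f : V1 -> V2) (h : V2 -> W) x v :
  differentiable f x -> differentiable h (f x) ->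
  'D_v (h \o f) x = 'D_('D_v f x) h (f x).
Proof.
move=> df dh; rewrite (deriveE _ (differentiable_comp df dh)) (deriveE _ df) (deriveE _ dh).
by have /(congr1 (fun f => f v)) := diff_comp df dh.
Qed.

(** * Derivatives along a variable vector field *)

Section FieldDerivative.
Context {R : realType} {n : nat}.
Implicit Types (f : 'rV[R]_n -> R^o) (eta : 'rV[R]_n -> 'rV[R]_n).

Lemma smooth_on_field_derive (A : set 'rV[R]_n) f eta :
  open A -> smooth_on A f -> smooth_on A eta ->
  smooth_on A (fun y => 'D_(eta y) f y).
Proof.
move=> oA sf se.
apply: (smooth_on_eq (f := fun y => \sum_i (eta y 0 i * 'D_('e_i) f y : R^o))) => //.
  by move=> x Ax; rewrite derive_row_basis//; exact: smooth_on_differentiable sf Ax.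
apply: smooth_on_sum => // i; apply: smooth_onM => //.
  exact: smooth_on_coord.
exact: smooth_on_derive.
Qed.

(** Both the direction and the point of differentiation vary with y. Expanding [eta] in the standard
    basis turns this into the product rule for scalar functions. *)
Lemma derive_field_derive (A : set 'rV[R]_n) f eta u x :
  open A -> A x -> smooth_on A f -> differentiable eta x ->
  'D_u (fun y => 'D_(eta y) f y) x = 'D_('D_u eta x) f x + 'D_u ('D_(eta x) f) x.
Proof.
move=> oA Ax sf de.
have df y : A y -> differentiable f y by exact: smooth_on_differentiable.
have dDf v : differentiable ('D_v f) x.
  exact: smooth_on_differentiable (smooth_on_derive v sf) Ax.
have nA : \forall y \near x, A y by exact: open_nbhs_nbhs.
have -> : 'D_u (fun y => 'D_(eta y) f y) x =
    \sum_i 'D_u ((fun y => eta y 0 i : R) * ('D_('e_i) f : _ -> R)) x.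
  rewrite -derive_sum; last first.
    move=> i; apply: derivableM; apply: diff_derivable; last exact: dDf.
    exact: (differentiable_comp de (differentiable_coord _ _ _)).
  apply: near_eq_derive; near=> y; rewrite fct_sumE derive_row_basis//.
  by apply: df; near: y.
have -> : 'D_u ('D_(eta x) f) x = \sum_i eta x 0 i * 'D_u ('D_('e_i) f) x.
  rewrite (_ : \sum_i _ = \sum_i 'D_u (eta x 0 i *: ('D_('e_i) f)) x); last first.
    by apply: eq_bigr => i _; rewrite deriveZ//; exact: diff_derivable.
  rewrite -derive_sum; last by move=> i; apply: derivableZ; exact: diff_derivable.
  apply: near_eq_derive; near=> y; rewrite fct_sumE derive_row_basis//.
  by apply: df; near: y.
rewrite derive_row_basis; last exact: df.
rewrite -big_split; apply: eq_bigr => i _ /=.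
rewrite deriveM; last 2 first.
  apply: diff_derivable.
  exact: (differentiable_comp de (differentiable_coord _ _ _)).
  exact: diff_derivable.
rewrite addrC; congr (_ + _); rewrite [LHS]mulrC; congr (_ * _).
by apply: derive_coord; exact: diff_derivable.
Unshelve. all: by end_near. Qed.

End FieldDerivative.

(** * Symmetric bilinear forms on R^3 *)

Lemma forall_ord3 (P : 'I_3 -> Prop) : P 0 -> P 1 -> P 2 -> forall i, P i.
Proof.
move=> P0 P1 P2 [[|[|[|//]]] i3].
- by rewrite (_ : Ordinal _ = 0)//; exact/val_inj.
- by rewrite (_ : Ordinal _ = 1)//; exact/val_inj.
- by rewrite (_ : Ordinal _ = 2)//; exact/val_inj.
Qed.

Lemma sum_ord3 (V : nmodType) (f : 'I_3 -> V) : \sum_i f i = f 0 + f 1 + f 2.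
Proof.
rewrite !big_ord_recl big_ord0 addr0 addrA.
by congr (_ + f _ + f _); apply/val_inj.
Qed.

(** At distance [M] from 0 the cubic term dominates the others, so the polynomial changes sign on
    [-M, M]. *)
Lemma monic_cubic_root (R : rcfType) (p : {poly R}) :
  p \is monic -> size p = 4%N -> exists x, root p x.
Proof.
move=> pm p4; have pE x : p.[x] = p`_0 + p`_1 * x + p`_2 * x ^+ 2 + x ^+ 3.
  have p3 : p`_3 = 1 by move/monicP: pm; rewrite /lead_coef p4.
  by rewrite horner_coef p4 !big_ord_recl big_ord0 /= expr0 mulr1 addr0 p3 mul1r expr1 !addrA.
pose M := 1 + `|p`_0| + `|p`_1| + `|p`_2|.
have n0 := normr_ge0 p`_0; have n1 := normr_ge0 p`_1; have n2 := normr_ge0 p`_2.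
have M1 : 1 <= M by rewrite /M; lra.
have M2 : M <= M ^+ 2 by rewrite expr2 ler_peMr//; lra.
have bound (x : R) : `|x| = M -> `|p`_0 + p`_1 * x + p`_2 * x ^+ 2| <= M ^+ 3.
  move=> xM; rewrite (le_trans (ler_normD _ _))//.
  rewrite (le_trans (lerD (ler_normD _ _) (lexx _)))//.
  rewrite [`|_ * x|]normrM [`|_ * x ^+ 2|]normrM normrX xM.
  rewrite (@le_trans _ _ ((`|p`_0| + `|p`_1| + `|p`_2|) * M ^+ 2))//.
    rewrite !mulrDl !lerD// ?ler_wpM2l//.
    by rewrite ler_peMr//; lra.
  by rewrite exprS ler_wpM2r ?sqr_ge0// /M; lra.
have [||x _ rx] := @poly_ivt _ p (- M) M; last by exists x.
- by lra.
rewrite !pE; apply/andP; split.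
  have := bound (- M); rewrite normrN ger0_norm; last by lra.
  move=> /(_ erefl); rewrite ler_norml => /andP[_].
  by rewrite [(- M) ^+ 3]exprNn; lra.
have := bound M; rewrite ger0_norm; last by lra.
by move=> /(_ erefl); rewrite ler_norml => /andP[+ _]; lra.
Qed.

Section SymmetricForms.
Context {R : rcfType}.
Local Notation V := 'rV[R]_3.

Definition symmetric_bilinear (f : V -> V -> R) : Prop :=
  (forall a u v w, f (a *: u + v) w = a * f u w + f v w) /\
  (forall u v, f u v = f v u).

Section Form.
Variables (f : V -> V -> R) (sf : symmetric_bilinear f).

Lemma bformC u v : f u v = f v u. Proof. by case: sf. Qed.

Lemma bform0l w : f 0 w = 0.
Proof. by have := sf.1 1 0 0 w; rewrite scaler0 addr0; lra. Qed.

Lemma bformDl u v w : f (u + v) w = f u w + f v w.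
Proof. by rewrite -[u]scale1r sf.1 scale1r mul1r. Qed.

Lemma bformZl a u w : f (a *: u) w = a * f u w.
Proof. by rewrite -[a *: u]addr0 sf.1 bform0l addr0. Qed.

Lemma bformDr u v w : f w (u + v) = f w u + f w v.
Proof. by rewrite !(bformC w) bformDl. Qed.

Lemma bformZr a u w : f w (a *: u) = a * f w u.
Proof. by rewrite !(bformC w) bformZl. Qed.

Lemma bform_suml (I : Type) (r : seq I) (u : I -> V) w :
  f (\sum_(i <- r) u i) w = \sum_(i <- r) f (u i) w.
Proof.
by elim: r => [|i r IH]; rewrite ?big_nil ?bform0l// !big_cons bformDl IH.
Qed.

Definition gram : 'M[R]_3 := \matrix_(i, j) f 'e_i 'e_j.

Lemma bform_gram u v : f u v = (u *m gram *m v^T) 0 0.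
Proof.
rewrite -mulmxA mxE {1}[u]row_sum_delta bform_suml; apply: eq_bigr => i _.
rewrite bformZl mxE [v in LHS]row_sum_delta bformC bform_suml; congr (_ * _).
by apply: eq_bigr => j _; rewrite bformZl !mxE mulrC bformC.
Qed.

End Form.

Variables (g h : V -> V -> R).
Hypotheses (sg : symmetric_bilinear g) (sh : symmetric_bilinear h).
Hypothesis g_gt0 : forall u, u != 0 -> 0 < g u u.

Lemma gram_unit : gram g \in unitmx.
Proof.
rewrite -row_free_unit; apply/row_freeP.
suff : row_free (gram g) by move=> /row_freeP.
rewrite -kermx_eq0; apply/eqP/row_matrixP => i; rewrite row0.
apply/eqP/contraT => ni; have := g_gt0 ni.
by rewrite bform_gram// -row_mul mulmx_ker row0 mul0mx mxE ltxx.
Qed.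

(** Eigenvectors of h relative to g are eigenvectors of gram h (gram g)^-1, whose characteristic
    polynomial is a monic cubic and so has a real root. *)
Lemma exists_eigenvector :
  exists (v : V) (a : R), v != 0 /\ forall w, h v w = a * g v w.
Proof.
pose A := gram h *m invmx (gram g).
have [a] := monic_cubic_root (char_poly_monic A) (size_char_poly A).
rewrite -eigenvalue_root_char => /eigenvalueP[v vA v0].
exists v, a; split=> // w; rewrite (bform_gram sh) (bform_gram sg).
have -> : v *m gram h = a *: (v *m gram g).
  by rewrite -[gram h](mulmxKV gram_unit) -/A mulmxA vA -scalemxAl.
by rewrite -scalemxAl mxE.
Qed.

Lemma exists_orthogonal k (B : 'M[R]_(k, 3)) : (k < 3)%N ->
  exists v : V, v != 0 /\ forall i, g v (row i B) = 0.
Proof.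
move=> k3; pose C := gram g *m B^T.
have : kermx C != 0.
  by rewrite kermx_eq0 /row_free neq_ltn (leq_ltn_trans (rank_leq_col _)).
move=> /rowV0Pn[v /sub_kermxP vC v0]; exists v; split=> // i.
by rewrite (bform_gram sg) tr_row colE !mulmxA -(mulmxA v) vC mul0mx mxE.
Qed.

Lemma exists_normalized v : v != 0 -> exists c, c != 0 /\ g (c *: v) (c *: v) = 1.
Proof.
move=> /g_gt0 gv; exists (Num.sqrt (g v v))^-1.
have s0 : Num.sqrt (g v v) != 0 by rewrite gt_eqF// sqrtr_gt0.
split; first by rewrite invr_neq0.
rewrite bformZl// bformZr// -[X in _ * (_ * X)](sqr_sqrtr (ltW gv)) expr2 mulKf//.
by rewrite mulVf.
Qed.


Lemma exists_unit_orthogonal k (B : 'M[R]_(k, 3)) : (k < 3)%N ->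
  exists v : V, g v v = 1 /\ forall i, g v (row i B) = 0.
Proof.
move=> k3; have [v [v0 vB]] := exists_orthogonal B k3.
have [c [_ cv]] := exists_normalized v0.
by exists (c *: v); split=> // i; rewrite bformZl// vB mulr0.
Qed.

(* With v = w2 + t w3 and w = - t w2 + w3, orthogonality for h is a quadratic
   equation in t with nonnegative discriminant. *)
Lemma exists_rotation (w2 w3 : V) :
  g w2 w2 = 1 -> g w3 w3 = 1 -> g w2 w3 = 0 ->
  exists c s : R, let v2 := c *: w2 + s *: w3 in let v3 := - s *: w2 + c *: w3 in
  [/\ g v2 v2 = 1, g v3 v3 = 1, g v2 v3 = 0 & h v2 v3 = 0].
Proof.
move=> g22 g33 g23; have g32 : g w3 w2 = 0 by rewrite bformC.
have [h0|h0] := eqVneq (h w2 w3) 0.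
  exists 1, 0; rewrite /= oppr0 !scale0r !scale1r addr0 add0r; by split.
set al := h w2 w2; set be := h w2 w3 in h0 *; set ga := h w3 w3.
have h32 : h w3 w2 = be by rewrite bformC.
pose D := (ga - al) ^+ 2 + 4 * be ^+ 2.
have D0 : 0 <= D by rewrite /D addr_ge0 ?sqr_ge0// pmulr_rge0 ?sqr_ge0 ?ltr0n.
pose t := (ga - al + Num.sqrt D) / (2 * be).
have tE : be * t ^+ 2 - (ga - al) * t - be = 0.
  have -> : be * t ^+ 2 - (ga - al) * t - be
    = (Num.sqrt D ^+ 2 - D) / (4 * be).
    by rewrite /t /D; field; rewrite h0.
  by rewrite sqr_sqrtr// subrr mul0r.
have n0 : 0 < 1 + t ^+ 2 by rewrite ltr_wpDr ?sqr_ge0.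
pose k := (Num.sqrt (1 + t ^+ 2))^-1.
have k2 : k * k * (1 + t ^+ 2) = 1.
  by rewrite /k -[X in _ * X = _](sqr_sqrtr (ltW n0)); field; rewrite gt_eqF// sqrtr_gt0.
exists k, (t * k) => /=.
rewrite !(bformDl sg, bformDr sg, bformZl sg, bformZr sg) !(bformDl sh, bformDr sh, bformZl sh, bformZr sh).
rewrite g22 g33 g23 g32 -/al -/be -/ga h32.
split; [by rewrite -[RHS]k2; ring|by rewrite -[RHS]k2; ring|by ring|].
rewrite (_ : _ + _ = - (k * k) * (be * t ^+ 2 - (ga - al) * t - be)); last by ring.
by rewrite tE mulr0.
Qed.

Definition orthonormal_basis (b : 'I_3 -> V) : Prop :=
  forall i j, g (b i) (b j) = (i == j)%:R.

Definition triple (x y z : V) : 'I_3 -> V := fun i => nth 0 [:: x; y; z] i.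

Lemma orthonormal_triple x y z :
  g x x = 1 -> g y y = 1 -> g z z = 1 -> g x y = 0 -> g x z = 0 -> g y z = 0 ->
  orthonormal_basis (triple x y z).
Proof.
move=> xx yy zz xy xz yz.
by apply: forall_ord3; apply: forall_ord3; rewrite /triple//= bformC.
Qed.

(** One eigenvector is split off, and a rotation diagonalizes [h] on its orthogonal plane. The last
    clause fixes the order: a zero eigenvalue is placed last, so that a nonzero last eigenvalue
    already means rank 3. *)
Lemma exists_diagonal_basis : exists b, [/\ orthonormal_basis b,
  forall i j, i != j -> h (b i) (b j) = 0 &
  h (b 2) (b 2) != 0 -> h (b 0) (b 0) * h (b 1) (b 1) != 0].
Proof.
have [v1' [a [v10 hv1]]] := exists_eigenvector.
have [c1 [_ g11]] := exists_normalized v10.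
set v1 := c1 *: v1' in g11.
have {}hv1 w : h v1 w = a * g v1 w by rewrite !bformZl// hv1 mulrCA.
have [w2 [g22 /(_ 0)]] := @exists_unit_orthogonal 1 v1 isT.
rewrite row_id => g21.
have [w3 [g33 g3]] := @exists_unit_orthogonal (1 + 1) (col_mx v1 w2) isT.
have g31 : g w3 v1 = 0.
  by rewrite -[RHS](g3 (@lshift 1 1 ord0)) rowKu row_id.
have g32 : g w3 w2 = 0.
  by rewrite -[RHS](g3 (@rshift 1 1 ord0)) rowKd row_id.
have g23 : g w2 w3 = 0 by rewrite bformC.
have [c [s]] := exists_rotation g22 g33 g23.
set v2 := _ + _; set v3 := _ + _ => /= -[G22 G33 G23 H23].
have g12 : g v1 v2 = 0 by rewrite bformC// bformDl// !bformZl// g21 g31 !mulr0 addr0.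
have g13 : g v1 v3 = 0 by rewrite bformC// bformDl// !bformZl// g21 g31 !mulr0 addr0.
have H12 : h v1 v2 = 0 by rewrite hv1 g12 mulr0.
have H13 : h v1 v3 = 0 by rewrite hv1 g13 mulr0.
have [gC hC] := (bformC sg, bformC sh).
have hoff x y z : h x y = 0 -> h x z = 0 -> h y z = 0 ->
    forall i j, i != j -> h (triple x y z i) (triple x y z j) = 0.
  by move=> xy xz yz; apply: forall_ord3; apply: forall_ord3; rewrite /triple//= hC.
have [z1|n1] := eqVneq (h v1 v1) 0.
  exists (triple v3 v2 v1); rewrite /triple/= z1 eqxx; split=> //.
  - by apply: orthonormal_triple; rewrite // gC.
  - by apply: hoff; rewrite // hC.
have [z2|n2] := eqVneq (h v2 v2) 0.
  exists (triple v1 v3 v2); rewrite /triple/= z2 eqxx; split=> //.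
  - by apply: orthonormal_triple; rewrite // gC.
  - by apply: hoff; rewrite // hC.
exists (triple v1 v2 v3); split.
- exact: orthonormal_triple.
- exact: hoff.
- by rewrite /triple/= mulf_neq0.
Qed.

End SymmetricForms.

(** * Gauss and Codazzi equations of a hypersurface of R^4 *)

Section MovingFrame.
Context {R : realType} {T : Type}.
(* sm is a class of smooth functions on A, and X i f is the derivative of f
   along the i-th field of a frame. *)
Variables (A : set T) (sm : (T -> R) -> Prop) (X : 'I_3 -> (T -> R) -> T -> R).
Hypothesis sm_cst : forall a, sm (fun=> a).
Hypothesis smD : forall f g, sm f -> sm g -> sm (fun x => f x + g x).
Hypothesis smM : forall f g, sm f -> sm g -> sm (fun x => f x * g x).
Hypothesis smX : forall i f, sm f -> sm (X i f).
Hypothesis X_eq : forall i f g x, (forall y, A y -> f y = g y) -> A x ->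
  X i f x = X i g x.
Hypothesis X_cst : forall i a x, X i (fun=> a) x = 0.
Hypothesis XD : forall i f g x, sm f -> sm g -> A x ->
  X i (fun y => f y + g y) x = X i f x + X i g x.
Hypothesis XM : forall i f g x, sm f -> sm g -> A x ->
  X i (fun y => f y * g y) x = X i f x * g x + f x * X i g x.
Variable c : 'I_3 -> 'I_3 -> 'I_3 -> R.
Hypothesis X_bracket : forall i j f x, sm f -> A x ->
  X i (X j f) x - X j (X i f) x = \sum_k c i j k * X k f x.

(** Koszul's formula for the k-th component of \nabla_(e_i) e_j; the derivatives of the metric
    coefficients drop out in an orthonormal frame. *)
Definition christoffel i j k : R := (c i j k - c j k i + c k i j) / 2.

Implicit Types u v w : 'I_4 -> T -> R.

Definition dot4 u v (x : T) : R := \sum_a u a x * v a x.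
Definition Xv i u : 'I_4 -> T -> R := fun a => X i (u a).
Definition smv u := forall a, sm (u a).

Lemma dot4C u v x : dot4 u v x = dot4 v u x.
Proof. by apply: eq_bigr => a _; rewrite mulrC. Qed.

Lemma smvX i u : smv u -> smv (Xv i u).
Proof. by move=> su a; exact: smX. Qed.

Lemma sm_sum (I : Type) (r : seq I) (f : I -> T -> R) :
  (forall i, sm (f i)) -> sm (fun x => \sum_(i <- r) f i x).
Proof.
move=> sf; elim: r => [|i r IH].
  by under eq_fun do rewrite big_nil; exact: sm_cst.
by under eq_fun do rewrite big_cons; exact: smD.
Qed.

Lemma X_constant i f a x : (forall y, A y -> f y = a) -> A x -> X i f x = 0.
Proof. by move=> fa Ax; rewrite -[RHS](X_cst i a x); exact: X_eq. Qed.

Lemma X_sum i (I : Type) (r : seq I) (f : I -> T -> R) x :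
  (forall i, sm (f i)) -> A x ->
  X i (fun x => \sum_(j <- r) f j x) x = \sum_(j <- r) X i (f j) x.
Proof.
move=> sf Ax; elim: r => [|j r IH].
  by under eq_fun do rewrite big_nil; rewrite big_nil X_cst.
under eq_fun do rewrite big_cons; rewrite big_cons XD ?IH//.
exact: sm_sum.
Qed.

Lemma sm_dot4 u v : smv u -> smv v -> sm (dot4 u v).
Proof. by move=> su sv; apply: sm_sum => a; exact: smM. Qed.

Lemma X_dot4 i u v x : smv u -> smv v -> A x ->
  X i (dot4 u v) x = dot4 (Xv i u) v x + dot4 u (Xv i v) x.
Proof.
move=> su sv Ax; rewrite X_sum// => [|a]; last exact: smM.
by rewrite -big_split; apply: eq_bigr => a _; rewrite XM.
Qed.

Lemma dot4_bracket i j u v x : smv u -> A x ->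
  dot4 (Xv i (Xv j u)) v x - dot4 (Xv j (Xv i u)) v x
  = \sum_k c i j k * dot4 (Xv k u) v x.
Proof.
move=> su Ax; rewrite -sumrB.
under [RHS]eq_bigr do rewrite mulr_sumr.
rewrite exchange_big; apply: eq_bigr => a _.
by rewrite -mulrBl X_bracket// mulr_suml; apply: eq_bigr => k _; rewrite mulrA.
Qed.

Variables (phi N : 'I_4 -> T -> R).
Hypothesis sphi : smv phi.
Hypothesis sN : smv N.
Let Phi i := Xv i phi.
Hypothesis Phi_orthonormal : forall i j x, A x -> dot4 (Phi i) (Phi j) x = (i == j)%:R.
Hypothesis N_unit : forall x, A x -> dot4 N N x = 1.
Hypothesis N_normal : forall i x, A x -> dot4 (Phi i) N x = 0.

Let sPhi i : smv (Phi i). Proof. exact: smvX. Qed.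

Definition second_form i j : T -> R := dot4 (Xv i (Phi j)) N.
Local Notation h := second_form.
Local Notation Gam := christoffel.

Lemma sm_second_form i j : sm (h i j).
Proof. by apply: sm_dot4 => //; exact: smvX. Qed.

(** The difference is the normal part of the derivative of [phi] along a bracket, which is
    tangent. *)
Lemma second_form_sym i j x : A x -> h i j x = h j i x.
Proof.
move=> Ax; apply/eqP; rewrite -subr_eq0; apply/eqP.
rewrite /h /Phi dot4_bracket// big1// => k _; rewrite N_normal ?mulr0//.
Qed.

Lemma dot4_Phi_skew i j k x : A x ->
  dot4 (Xv i (Phi j)) (Phi k) x + dot4 (Xv i (Phi k)) (Phi j) x = 0.
Proof.
move=> Ax; rewrite [X in _ + X]dot4C -X_dot4//.
by apply: X_constant Ax => y Ay; exact: Phi_orthonormal.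
Qed.

Lemma dot4_Phi_torsion i j k x : A x ->
  dot4 (Xv i (Phi j)) (Phi k) x - dot4 (Xv j (Phi i)) (Phi k) x = c i j k.
Proof.
move=> Ax; rewrite dot4_bracket// (bigD1 k)//= big1 => [|l lk].
  by rewrite -/(Phi k) Phi_orthonormal// eqxx mulr1 addr0.
by rewrite -/(Phi l) Phi_orthonormal// (negbTE lk) mulr0.
Qed.

(** The uniqueness argument for the Levi-Civita connection: skewness in the last two indices and the
    prescribed torsion determine the tangential part. *)
Lemma dot4_XPhi i j k x : A x -> dot4 (Xv i (Phi j)) (Phi k) x = Gam i j k.
Proof.
move=> Ax; rewrite /Gam -!(dot4_Phi_torsion _ _ _ Ax).
have := dot4_Phi_skew i j k Ax; have := dot4_Phi_skew j i k Ax.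
have := dot4_Phi_skew k i j Ax; lra.
Qed.


Lemma dot4_XN i j x : A x -> dot4 (Xv i N) (Phi j) x = - h i j x.
Proof.
move=> Ax; apply/eqP; rewrite -addr_eq0 addrC [X in _ + X]dot4C -X_dot4//.
by apply/eqP/(X_constant _ _ Ax) => y Ay; exact: N_normal.
Qed.

Lemma dot4_XNN i x : A x -> dot4 (Xv i N) N x = 0.
Proof.
move=> Ax; have : X i (dot4 N N) x = 0.
  by apply: X_constant Ax => y Ay; exact: N_unit.
rewrite X_dot4// [X in _ + X]dot4C; lra.
Qed.

(** Parseval's identity: the frame [Phi], [N] gives a square matrix with B B^T = 1, hence also B^T B
    = 1. *)
Lemma dot4_expand u v x : A x ->
  dot4 u v x = \sum_k dot4 u (Phi k) x * dot4 v (Phi k) x + dot4 u N x * dot4 v N x.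
Proof.
move=> Ax; pose row4 (w : 'I_4 -> T -> R) : 'rV[R]_4 := \row_a w a x.
have dotE w w' : dot4 w w' x = (row4 w *m (row4 w')^T) 0 0.
  by rewrite mxE; apply: eq_bigr => a _; rewrite !mxE.
pose B : 'M[R]_(3 + 1) := col_mx (\matrix_(i, a) Phi i a x) (row4 N).
have BB : B *m B^T = 1%:M.
  rewrite tr_col_mx mul_col_row [RHS](scalar_mx_block 3 1).
  congr block_mx; apply/matrixP => i j; rewrite !mxE.
  - rewrite -(Phi_orthonormal i j Ax); by apply: eq_bigr => a _; rewrite !mxE.
  - rewrite -[RHS](N_normal i Ax); by apply: eq_bigr => a _; rewrite !mxE.
  - rewrite -[RHS](N_normal j Ax) dot4C; by apply: eq_bigr => a _; rewrite !mxE.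
  - rewrite !ord1 -(N_unit Ax); by apply: eq_bigr => a _; rewrite !mxE.
have {}BB : B^T *m B = 1%:M := mulmx1C BB.
have -> : dot4 u v x = ((row4 u *m B^T) *m (row4 v *m B^T)^T) 0 0.
  by rewrite trmx_mul trmxK mulmxA -(mulmxA (row4 u)) BB mulmx1 dotE.
rewrite tr_col_mx !mul_mx_row tr_row_mx mul_row_col mxE; congr (_ + _).
  rewrite mxE; apply: eq_bigr => k _; rewrite !mxE.
  by congr (_ * _); apply: eq_bigr => a _; rewrite !mxE.
by rewrite !dotE mxE big_ord1 ![_^T 0 0]mxE.
Qed.

(** The tangential components of the first derivatives of [Phi] are constants, so differentiating
    them expresses the tangential second derivatives by products of first ones. Antisymmetrizing in
    i and j and comparing with the bracket gives the equation. *)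
Lemma gauss_equation i j l m x : A x ->
  h i l x * h j m x - h j l x * h i m x
  = \sum_k c i j k * Gam k l m
    + \sum_k (Gam j l k * Gam i m k - Gam i l k * Gam j m k).
Proof.
move=> Ax.
have second i' j' : dot4 (Xv i' (Xv j' (Phi l))) (Phi m) x
    = - (\sum_k Gam j' l k * Gam i' m k + h j' l x * h i' m x).
  have : X i' (dot4 (Xv j' (Phi l)) (Phi m)) x = 0.
    by apply: X_constant Ax => y Ay; exact: dot4_XPhi.
  rewrite X_dot4//; last exact: smvX.
  rewrite (dot4_expand (Xv j' (Phi l))) //.
  under eq_bigr do rewrite !dot4_XPhi//.
  by move=> /eqP; rewrite addr_eq0 => /eqP.
have := dot4_bracket i j (Phi m) (sPhi l) Ax.
rewrite !second; under [RHS]eq_bigr do rewrite dot4_XPhi//.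
rewrite sumrB; lra.
Qed.

(** The normal counterpart of the Gauss equation: here the component that is differentiated is h
    itself, so its derivatives remain. *)
Lemma codazzi_equation i j l x : A x ->
  X i (h j l) x - X j (h i l) x
  = \sum_k (c i j k * h k l x + Gam i l k * h j k x - Gam j l k * h i k x).
Proof.
move=> Ax.
have second i' j' : dot4 (Xv i' (Xv j' (Phi l))) N x
    = X i' (h j' l) x + \sum_k Gam j' l k * h i' k x.
  rewrite [X in X + _]X_dot4//; last exact: smvX.
  rewrite (dot4_expand (Xv j' (Phi l))) // dot4_XNN// mulr0 addr0.
  rewrite -addrA -big_split/= big1 ?addr0// => k _.
  by rewrite dot4_XPhi// dot4_XN// mulrN addNr.
have := dot4_bracket i j N (sPhi l) Ax; rewrite !second.
under eq_bigr do rewrite -/(h _ _ x).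
rewrite !sumrB !big_split/=; lra.
Qed.

Lemma derive_gauss_equation p i j l m x : A x ->
  X p (h i l) x * h j m x + h i l x * X p (h j m) x
  - (X p (h j l) x * h i m x + h j l x * X p (h i m) x) = 0.
Proof.
move=> Ax.
have sh := sm_second_form; have shM a b a' b' := smM (sh a b) (sh a' b').
have E y : A y -> h i l y * h j m y = h j l y * h i m y +
    (\sum_k c i j k * Gam k l m
    + \sum_k (Gam j l k * Gam i m k - Gam i l k * Gam j m k)).
  by move=> Ay; rewrite -(gauss_equation i j l m Ay) addrC subrK.
by rewrite -!XM// (X_eq p E Ax) XD// X_cst addr0 subrr.
Qed.

End MovingFrame.

(** * The unit normal as a triple cross product in R^4 *)

Section NormalVector.
Context {R : realType}.
Implicit Types p q r : 'I_4 -> R.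

Definition det3 p q r (i j k : 'I_4) : R :=
  p i * (q j * r k - q k * r j) - p j * (q i * r k - q k * r i)
  + p k * (q i * r j - q j * r i).

(** The signed 3x3 minors of the matrix with rows p, q, r. Being polynomial in the entries, they
    yield a normal that is smooth wherever the frame is. *)
Definition cross4 p q r (a : 'I_4) : R :=
  nth 0 [:: det3 p q r 1 2 3; - det3 p q r 0 2 3;
            det3 p q r 0 1 3; - det3 p q r 0 1 2] a.

Lemma sum_ord4 (f : 'I_4 -> R) : \sum_a f a = f 0 + f 1 + f 2 + f 3.
Proof.
rewrite !big_ord_recl big_ord0 addr0 !addrA.
by congr (_ + f _ + f _ + f _); apply/val_inj.
Qed.

Lemma cross4_normal p q r :
  [/\ \sum_a p a * cross4 p q r a = 0, \sum_a q a * cross4 p q r a = 0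
    & \sum_a r a * cross4 p q r a = 0].
Proof. by split; rewrite sum_ord4 /cross4 /= /det3; ring. Qed.

Lemma cross4_unit p q r :
  \sum_a p a * p a = 1 -> \sum_a q a * q a = 1 -> \sum_a r a * r a = 1 ->
  \sum_a p a * q a = 0 -> \sum_a p a * r a = 0 -> \sum_a q a * r a = 0 ->
  \sum_a cross4 p q r a * cross4 p q r a = 1.
Proof.
set pp := \sum_a p a * p a; set qq := \sum_a q a * q a; set rr := \sum_a r a * r a.
set pq := \sum_a p a * q a; set pr := \sum_a p a * r a; set qr := \sum_a q a * r a.
(* By Cauchy-Binet the squared length is the Gram determinant. *)
have -> : \sum_a cross4 p q r a * cross4 p q r a
  = pp * (qq * rr - qr * qr) - pq * (pq * rr - qr * pr) + pr * (pq * qr - qq * pr).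
  by rewrite /pp /qq /rr /pq /pr /qr !sum_ord4 /cross4 /= /det3; ring.
by move=> -> -> -> -> -> ->; ring.
Qed.

End NormalVector.

(** * Algebra of the Gauss and Codazzi equations *)

Lemma sum_sqr3_le0 (R : realDomainType) (x y z : R) :
  x ^+ 2 + y ^+ 2 + z ^+ 2 <= 0 -> [/\ x = 0, y = 0 & z = 0].
Proof.
move=> le0; have := sqr_ge0 x; have := sqr_ge0 y; have := sqr_ge0 z => z0 y0 x0.
by split; apply/eqP; rewrite -sqrf_eq0; apply/eqP; lra.
Qed.

(* M S M^T is both theta M^T and theta M. *)
Lemma sym_of_mul_scalar (R : realFieldType)
    (m11 m12 m13 m21 m22 m23 m31 m32 m33 s11 s12 s13 s22 s23 s33 t : R) :
  t != 0 ->
  [/\ m11 * s11 + m12 * s12 + m13 * s13 = t,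
      m11 * s12 + m12 * s22 + m13 * s23 = 0 &
      m11 * s13 + m12 * s23 + m13 * s33 = 0] ->
  [/\ m21 * s11 + m22 * s12 + m23 * s13 = 0,
      m21 * s12 + m22 * s22 + m23 * s23 = t &
      m21 * s13 + m22 * s23 + m23 * s33 = 0] ->
  [/\ m31 * s11 + m32 * s12 + m33 * s13 = 0,
      m31 * s12 + m32 * s22 + m33 * s23 = 0 &
      m31 * s13 + m32 * s23 + m33 * s33 = t] ->
  [/\ m12 = m21, m13 = m31 & m23 = m32].
Proof.
move=> t0 [A1 A2 A3] [B1 B2 B3] [C1 C2 C3].
have a1 : m21 * (m11 * s11 + m12 * s12 + m13 * s13)
    + m22 * (m11 * s12 + m12 * s22 + m13 * s23)
    + m23 * (m11 * s13 + m12 * s23 + m13 * s33) = m21 * t.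
  by rewrite A1 A2 A3 !mulr0 !addr0.
have b1 : m11 * (m21 * s11 + m22 * s12 + m23 * s13)
    + m12 * (m21 * s12 + m22 * s22 + m23 * s23)
    + m13 * (m21 * s13 + m22 * s23 + m23 * s33) = m12 * t.
  by rewrite B1 B2 B3 !mulr0 add0r addr0.
have a2 : m31 * (m11 * s11 + m12 * s12 + m13 * s13)
    + m32 * (m11 * s12 + m12 * s22 + m13 * s23)
    + m33 * (m11 * s13 + m12 * s23 + m13 * s33) = m31 * t.
  by rewrite A1 A2 A3 !mulr0 !addr0.
have c2 : m11 * (m31 * s11 + m32 * s12 + m33 * s13)
    + m12 * (m31 * s12 + m32 * s22 + m33 * s23)
    + m13 * (m31 * s13 + m32 * s23 + m33 * s33) = m13 * t.
  by rewrite C1 C2 C3 !mulr0 !add0r.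
have b3 : m31 * (m21 * s11 + m22 * s12 + m23 * s13)
    + m32 * (m21 * s12 + m22 * s22 + m23 * s23)
    + m33 * (m21 * s13 + m22 * s23 + m23 * s33) = m32 * t.
  by rewrite B1 B2 B3 !mulr0 add0r addr0.
have c3 : m21 * (m31 * s11 + m32 * s12 + m33 * s13)
    + m22 * (m31 * s12 + m32 * s22 + m33 * s23)
    + m23 * (m31 * s13 + m32 * s23 + m33 * s33) = m23 * t.
  by rewrite C1 C2 C3 !mulr0 !add0r.
by split; apply: (mulfI t0); lra.
Qed.

Section CurvatureAlgebra.
Context {R : realFieldType}.
Variables p11 p12 p13 p21 p22 p23 p31 p32 p33 : R.
(** The trace of P = (p_ij) and, below, the sum of its principal 2x2 minors. *)
Local Notation tau := (p11 + p22 + p33).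
Local Notation sigma :=
  (p22 * p33 - p23 * p32 + (p11 * p33 - p13 * p31) + (p11 * p22 - p12 * p21)).

(* With rows p_i such that \nabla_(e_i) e_j = p_i x e_j, this is the Gauss
   equation cof P - tau P + P^T P = - diag(k1, k2, k3). *)
Definition curvature_eqs (k1 k2 k3 : R) : Prop :=
  [/\ [/\ p22 * p33 - p23 * p32 - tau * p11 + (p11 * p11 + p21 * p21 + p31 * p31) = - k1,
      p23 * p31 - p21 * p33 - tau * p12 + (p11 * p12 + p21 * p22 + p31 * p32) = 0 &
      p21 * p32 - p22 * p31 - tau * p13 + (p11 * p13 + p21 * p23 + p31 * p33) = 0],
      [/\ p13 * p32 - p12 * p33 - tau * p21 + (p12 * p11 + p22 * p21 + p32 * p31) = 0,
      p11 * p33 - p13 * p31 - tau * p22 + (p12 * p12 + p22 * p22 + p32 * p32) = - k2 &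
      p12 * p31 - p11 * p32 - tau * p23 + (p12 * p13 + p22 * p23 + p32 * p33) = 0] &
      [/\ p12 * p23 - p13 * p22 - tau * p31 + (p13 * p11 + p23 * p21 + p33 * p31) = 0,
      p13 * p21 - p11 * p23 - tau * p32 + (p13 * p12 + p23 * p22 + p33 * p32) = 0 &
      p11 * p22 - p12 * p21 - tau * p33 + (p13 * p13 + p23 * p23 + p33 * p33) = - k3]].

(* By Cayley-Hamilton the cofactor matrix of P is (P^T)^2 - tau P^T + sigma, so
   the equations read (tau - P^T) (P + P^T) = sigma + k. *)
Lemma curvature_eqs_const k : curvature_eqs k k k ->
  let m11 := tau - p11 in let m12 := - p21 in let m13 := - p31 in
  let m21 := - p12 in let m22 := tau - p22 in let m23 := - p32 in
  let m31 := - p13 in let m32 := - p23 in let m33 := tau - p33 in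
  [/\ [/\ m11 * (p11 + p11) + m12 * (p21 + p12) + m13 * (p31 + p13) - (sigma + k) = 0,
      m11 * (p12 + p21) + m12 * (p22 + p22) + m13 * (p32 + p23) = 0 &
      m11 * (p13 + p31) + m12 * (p23 + p32) + m13 * (p33 + p33) = 0],
      [/\ m21 * (p11 + p11) + m22 * (p21 + p12) + m23 * (p31 + p13) = 0,
      m21 * (p12 + p21) + m22 * (p22 + p22) + m23 * (p32 + p23) - (sigma + k) = 0 &
      m21 * (p13 + p31) + m22 * (p23 + p32) + m23 * (p33 + p33) = 0] &
      [/\ m31 * (p11 + p11) + m32 * (p21 + p12) + m33 * (p31 + p13) = 0,
      m31 * (p12 + p21) + m32 * (p22 + p22) + m33 * (p32 + p23) = 0 &
      m31 * (p13 + p31) + m32 * (p23 + p32) + m33 * (p33 + p33) - (sigma + k) = 0]].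
Proof. by move=> [[? ? ?] [? ? ?] [? ? ?]] /=; do 2!split; lra. Qed.


Lemma curvature_eqs_const_sym k : curvature_eqs k k k -> 0 <= k ->
  [/\ p12 = p21, p13 = p31 & p23 = p32].
Proof.
move=> E k0.
have [theta0|theta0] := eqVneq (sigma + k) 0.
  (* The sum of squares is |P|^2 - tr (P^2). The trace of the equations gives |P|^2 = tau^2 - sigma
     - 3k, and tr (P^2) = tau^2 - 2 sigma; with sigma = -k the difference is -4k. *)
  have : (p12 - p21) ^+ 2 + (p13 - p31) ^+ 2 + (p23 - p32) ^+ 2 <= 0.
    case: E => [[? ? ?] [? ? ?] [? ? ?]]; lra.
  by move=> /sum_sqr3_le0[] /subr0_eq ? /subr0_eq ? /subr0_eq ?.
have /= [[E11 E12 E13] [E21 E22 E23] [E31 E32 E33]] := curvature_eqs_const E.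
have e21 : p21 + p12 = p12 + p21 by rewrite addrC.
have e31 : p31 + p13 = p13 + p31 by rewrite addrC.
have e32 : p32 + p23 = p23 + p32 by rewrite addrC.
rewrite e21 e31 e32 in E11 E12 E13 E21 E22 E23 E31 E32 E33.
have [] := sym_of_mul_scalar theta0 (And3 (subr0_eq E11) E12 E13)
  (And3 E21 (subr0_eq E22) E23) (And3 E31 E32 (subr0_eq E33)).
by move=> /oppr_inj-> /oppr_inj-> /oppr_inj->.
Qed.

Lemma curvature_eqs_sphere k : curvature_eqs k k k -> 0 < k ->
  [/\ [/\ p12 = 0, p13 = 0 & p23 = 0], [/\ p21 = 0, p31 = 0 & p32 = 0],
      p22 = p11, p33 = p11 & p11 != 0].
Proof.
move=> E k0; have [s12 s13 s23] := curvature_eqs_const_sym E (ltW k0).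
have /= [[E11 E12 E13] [E21 E22 E23] [E31 E32 E33]] := curvature_eqs_const E.
case: E => [[F11 F12 F13] [F21 F22 F23] [F31 F32 F33]].
rewrite -s12 -s13 -s23 in E11 E12 E13 E21 E22 E23 E31 E32 E33 F11 F12 F13 F21 F22 F23 F31 F32 F33 *.
(* The cofactors of P are k on the diagonal and 0 elsewhere, hence k P = det P. *)
have sk : p22 * p33 - p23 * p23 + (p11 * p33 - p13 * p13) + (p11 * p22 - p12 * p12) = 3 * k.
  lra.
have C11 : p22 * p33 - p23 * p23 = k by lra.
have C22 : p11 * p33 - p13 * p13 = k by lra.
have C33 : p11 * p22 - p12 * p12 = k by lra.
have C12 : p23 * p13 - p12 * p33 = 0 by lra.
have C13 : p12 * p23 - p22 * p13 = 0 by lra.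
have C23 : p12 * p13 - p11 * p23 = 0 by lra.
have k00 : k != 0 by rewrite gt_eqF.
have D12 : p12 = 0.
  (* Expanding a determinant along one row with the cofactors of another row gives 0; only the
     diagonal cofactor k survives. *)
  have I : p11 * (p23 * p13 - p12 * p33) + p12 * (p11 * p33 - p13 * p13)
    + p13 * (p12 * p13 - p11 * p23) = 0 by ring.
  by move: I; rewrite C12 C22 C23 !mulr0 add0r addr0 => /(canRL (mulfK k00)); rewrite mul0r.
have D13 : p13 = 0.
  have I : p11 * (p12 * p23 - p22 * p13) + p12 * (p12 * p13 - p11 * p23)
    + p13 * (p11 * p22 - p12 * p12) = 0 by ring.
  by move: I; rewrite C13 C33 C23 !mulr0 !add0r => /(canRL (mulfK k00)); rewrite mul0r.
have D23 : p23 = 0.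
  have I : p12 * (p12 * p23 - p22 * p13) + p22 * (p12 * p13 - p11 * p23)
    + p23 * (p11 * p22 - p12 * p12) = 0 by ring.
  by move: I; rewrite C13 C33 C23 !mulr0 !add0r => /(canRL (mulfK k00)); rewrite mul0r.
move: C11 C22 C33; rewrite D12 D13 D23 !mulr0 !subr0 => C11 C22 C33.
have p11n0 : p11 != 0 by apply: contra_neq k00 => p0; rewrite -C22 p0 mul0r.
have p33n0 : p33 != 0 by apply: contra_neq k00 => p0; rewrite -C22 p0 mulr0.
split=> //.
  by apply: (mulIf p33n0); rewrite C11 C22.
have p22n0 : p22 != 0 by apply: contra_neq k00 => p0; rewrite -C11 p0 mul0r.
by apply: (mulfI p22n0); rewrite C11 mulrC C33.
Qed.

(* P is symmetric and sigma = 0 (the factor theta = sigma cannot be nonzero),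
   so that 2 cof P = sigma = 0. *)
Lemma curvature_eqs_flat : curvature_eqs 0 0 0 ->
  [/\ p21 = p12, p31 = p13 & p32 = p23] /\
  [/\ p22 * p33 = p23 ^+ 2, p11 * p33 = p13 ^+ 2 & p11 * p22 = p12 ^+ 2] /\
  [/\ p23 * p13 = p12 * p33, p12 * p23 = p22 * p13 & p12 * p13 = p11 * p23].
Proof.
move=> E; have [s12 s13 s23] := curvature_eqs_const_sym E (lexx _).
case: E => [[F11 F12 F13] [F21 F22 F23] [F31 F32 F33]].
rewrite -s12 -s13 -s23 in F11 F12 F13 F21 F22 F23 F31 F32 F33 *.
do !split=> //.
all: lra.
Qed.

(** The upper left 2x2 block is symmetric with determinant 0. If p33 were nonzero, everything else
    would vanish and force k = 0. Otherwise k = - (p13^2 + p23^2), so (p13, p23) is nonzero and the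
    mixed equations make the block trace-free, hence zero. *)
Lemma curvature_eqs_rank1 k : curvature_eqs 0 0 k -> k != 0 ->
  p31 = 0 -> p32 = 0 -> p21 = p12 ->
  [/\ p11 = 0, p12 = 0, p22 = 0 & p33 = 0] /\ p13 ^+ 2 + p23 ^+ 2 != 0.
Proof.
move=> [[F11 F12 F13] [F21 F22 F23] [F31 F32 F33]] k0 z31 z32 s12.
rewrite z31 z32 s12 in F11 F12 F13 F21 F22 F23 F31 F32 F33 *.
have x2 : p12 ^+ 2 = p11 * p22 by lra.
have r12 : p33 * p12 = 0 by lra.
have rd : p33 * (p22 - p11) = 0 by lra.
have [r0|rn0] := eqVneq p33 0; last first.
  have x0 : p12 = 0 by apply: (mulfI rn0); rewrite r12 mulr0.
  have d0 : p22 = p11 by apply/subr0_eq/(mulfI rn0); rewrite rd mulr0.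
  have p0 : p11 = 0 by move: x2; rewrite x0 d0 expr0n /= -expr2 => /esym/eqP; rewrite sqrf_eq0 => /eqP.
  rewrite d0 x0 p0 in F13 F23 F33.
  have z13 : p13 = 0 by apply: (mulfI rn0); lra.
  have z23 : p23 = 0 by apply: (mulfI rn0); lra.
  by case/eqP: k0; rewrite z13 z23 in F33; lra.
rewrite r0 in F11 F12 F13 F21 F22 F23 F31 F32 F33 *.
have n0 : p13 ^+ 2 + p23 ^+ 2 != 0.
  by apply: contra_neq k0 => n0; lra.
have t13 : (p11 + p22) * p13 = 0 by lra.
have t23 : (p11 + p22) * p23 = 0 by lra.
have t0 : p11 + p22 = 0.
  apply: (mulIf n0); rewrite mul0r mulrDr !expr2 !mulrA t13 t23 !mul0r addr0 //.
have [x0 z11 _] : [/\ p12 = 0, p11 = 0 & 0 = 0 :> R].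
  by apply: sum_sqr3_le0; rewrite x2 (_ : p22 = - p11); lra.
by split; [split=> //; lra|].
Qed.

(* The Codazzi equations when the second fundamental form is diag(a1, a2, a3)
   and has vanishing derivatives in the frame. *)
Definition codazzi_eqs (a1 a2 a3 : R) : Prop :=
  [/\ p11 * (a3 - a2) = p22 * (a1 - a3) /\ p22 * (a1 - a3) = p33 * (a2 - a1),
      p13 * (a1 - a2) = 0 /\ p23 * (a1 - a2) = 0,
      p21 * (a2 - a3) = 0 /\ p31 * (a2 - a3) = 0 &
      p12 * (a1 - a3) = 0 /\ p32 * (a1 - a3) = 0].

(** If exactly two of the a_i agree, the Codazzi equations kill enough of P for a diagonal Gauss
    equation to give a_i a_j = 0 for some i and j. If all differ, P is diagonal and a sign gives the
    contradiction. *)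
Lemma codazzi_eqs_rank3 (a1 a2 a3 : R) :
  codazzi_eqs a1 a2 a3 -> curvature_eqs (a2 * a3) (a1 * a3) (a1 * a2) ->
  a1 * a2 * a3 != 0 -> a2 = a1 /\ a3 = a1.
Proof.
move=> [[T12 T23] [z13 z23] [z21 z31] [z12 z32]].
move=> [[F11 F12 F13] [F21 F22 F23] [F31 F32 F33]] n0.
have zero (x y : R) : x * y = 0 -> y != 0 -> x = 0.
  by move=> /eqP; rewrite mulf_eq0 => /orP[/eqP//|/eqP->]; rewrite eqxx.
have contra P : a1 * a2 * a3 = 0 -> P by move=> /eqP; rewrite (negbTE n0).
have [e12|n12] := eqVneq a2 a1; have [e13|n13] := eqVneq a3 a1 => //.
- have d13 : a1 - a3 != 0 by rewrite subr_eq0 eq_sym.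
  rewrite e12 subrr mulr0 in T23; rewrite e12 T23 in T12; rewrite e12 in z21 z31.
  have p11_0 : p11 = 0 by apply: (zero _ (a1 - a3) _ d13); rewrite -opprB mulrN T12 oppr0.
  rewrite p11_0 (zero _ _ T23 d13) (zero _ _ z21 d13) (zero _ _ z31 d13) (zero _ _ z32 d13) in F11.
  by apply: contra; rewrite -mulrA (_ : a2 * a3 = 0) ?mulr0//; lra.
- have d12 : a1 - a2 != 0 by rewrite subr_eq0 eq_sym.
  rewrite e13 subrr mulr0 in T12 T23; rewrite e13 in z21 z31.
  have p33_0 : p33 = 0.
    by apply: (zero _ (a1 - a2) _ d12); rewrite -opprB mulrN -T23 oppr0.
  rewrite (zero _ _ T12 d12) p33_0 (zero _ _ z23 d12) in F11.
  rewrite -opprB mulrN in z21; rewrite -opprB mulrN in z31.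
  rewrite (zero _ _ (oppr_inj (etrans z21 (esym (oppr0 _)))) d12) in F11.
  rewrite (zero _ _ (oppr_inj (etrans z31 (esym (oppr0 _)))) d12) in F11.
  by apply: contra; rewrite -mulrA (_ : a2 * a3 = 0) ?mulr0//; lra.
have d12 : a1 - a2 != 0 by rewrite subr_eq0 eq_sym.
have d13 : a1 - a3 != 0 by rewrite subr_eq0 eq_sym.
have p13_0 := zero _ _ z13 d12; have p23_0 := zero _ _ z23 d12.
have p12_0 := zero _ _ z12 d13; have p32_0 := zero _ _ z32 d13.
have [e23|n23] := eqVneq a2 a3.
  rewrite e23 subrr mulr0 in T12; rewrite -T12 in T23.
  have p33_0 : p33 = 0.
    by apply: (zero _ (a1 - a3) _ d13); rewrite -e23 -opprB mulrN -T23 oppr0.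
  rewrite p13_0 p12_0 p32_0 (zero _ _ (esym T12) d13) p33_0 in F22.
  by apply: contra; rewrite mulrAC (_ : a1 * a3 = 0) ?mul0r//; lra.
have d23 : a2 - a3 != 0 by rewrite subr_eq0.
have p21_0 := zero _ _ z21 d23; have p31_0 := zero _ _ z31 d23.
rewrite p12_0 p13_0 p21_0 p23_0 p31_0 p32_0 in F11 F22 F33.
clear p12_0 p13_0 p21_0 p23_0 p31_0 p32_0 z12 z13 z21 z23 z31 z32 F12 F13 F21 F23 F31 F32.
(* If the common value in the Codazzi equations is nonzero, p11, p22, p33 are proportional to the
   inverses of a3 - a2, a1 - a3, a2 - a1, which sum to 0; if it is zero, p11 and p22 vanish. *)
have q0 : p22 * p33 + p11 * p33 + p11 * p22 = 0.
  have [t0|tn0] := eqVneq (p11 * (a3 - a2)) 0.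
    have p22_0 : p22 = 0 by apply: (zero _ (a1 - a3) _ d13); rewrite -T12.
    have p11_0 : p11 = 0 by apply: (zero _ (a2 - a3) _ d23); rewrite -opprB mulrN t0 oppr0.
    by rewrite p22_0 p11_0 !mul0r !addr0.
  apply: (mulfI tn0).
  have : p22 * p33 * (p11 * (a3 - a2)) + p11 * p33 * (p22 * (a1 - a3))
    + p11 * p22 * (p33 * (a2 - a1)) = 0 by ring.
  rewrite -T23 -T12; lra.
have A1 : a2 * a3 = - (2 * (p22 * p33)) by lra.
have A2 : a1 * a3 = - (2 * (p11 * p33)) by lra.
have A3 : a1 * a2 = - (2 * (p11 * p22)) by lra.
(* Multiplying the three identities gives (a1 a2 a3)^2 = - 8 (p11 p22 p33)^2. *)
apply: contra; apply/eqP; rewrite -sqrf_eq0; apply/eqP/le_anti; rewrite sqr_ge0 andbT.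
rewrite (_ : _ ^+ 2 = (a2 * a3) * (a1 * a3) * (a1 * a2)); last by ring.
rewrite A1 A2 A3 (_ : _ * _ * _ = - (8 * (p11 * p22 * p33) ^+ 2)); last by ring.
by rewrite oppr_le0 mulr_ge0// sqr_ge0.
Qed.

End CurvatureAlgebra.

(** * The Gauss and Codazzi equations at one point, in terms of structure constants *)

Section FrameAlgebra.
Context {R : realType}.
Variable c : 'I_3 -> 'I_3 -> 'I_3 -> R.
Hypothesis c_anti : forall i j k, c i j k = - c j i k.

Definition half_trace : R := (c 1 2 0 + c 2 0 1 + c 0 1 2) / 2.

(* The matrix P of curvature_eqs: if L is the matrix whose rows are [e2, e3],
   [e3, e1], [e1, e2], then P = tr(L) / 2 - L^T by Koszul's formula. *)
Definition with_connection_matrix (Q : R -> R -> R -> R -> R -> R -> R -> R -> R -> Prop) : Prop :=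
  Q (half_trace - c 1 2 0) (- c 2 0 0) (- c 0 1 0)
    (- c 1 2 1) (half_trace - c 2 0 1) (- c 0 1 1)
    (- c 1 2 2) (- c 2 0 2) (half_trace - c 0 1 2).

Definition gauss_eqs (h : 'I_3 -> 'I_3 -> R) : Prop := forall i j l m,
  h i l * h j m - h j l * h i m
  = \sum_k c i j k * christoffel c k l m
    + \sum_k (christoffel c j l k * christoffel c i m k
              - christoffel c i l k * christoffel c j m k).

(** [dh p i j] stands for the derivative of h_ij along e_p at the unit; it is an array of unknown
    numbers, to be eliminated. *)
Definition codazzi_frame_eqs (h : 'I_3 -> 'I_3 -> R) (dh : 'I_3 -> 'I_3 -> 'I_3 -> R) : Prop :=
  forall i j l, dh i j l - dh j i l
  = \sum_k (c i j k * h k l + christoffel c i l k * h j k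
            - christoffel c j l k * h i k).

Definition derive_gauss_eqs (h : 'I_3 -> 'I_3 -> R) (dh : 'I_3 -> 'I_3 -> 'I_3 -> R) : Prop :=
  forall p i j l m, dh p i l * h j m + h i l * dh p j m
    - (dh p j l * h i m + h j l * dh p i m) = 0.

Let c_diag i k : c i i k = 0.
Proof. by have := c_anti i i k; lra. Qed.

Let c_anti3 k : [/\ c 1 0 k = - c 0 1 k, c 2 1 k = - c 1 2 k & c 0 2 k = - c 2 0 k].
Proof. by split; exact: c_anti. Qed.

(** The hypotheses list the nine 2x2 minors of [h], that is, the matrix of h /\ h in the basis e2 /\
    e3, e3 /\ e1, e1 /\ e2. *)
Lemma gauss_curvature (h : 'I_3 -> 'I_3 -> R) (k1 k2 k3 : R) : gauss_eqs h ->
  h 1 1 * h 2 2 - h 2 1 * h 1 2 = k1 -> h 1 2 * h 2 0 - h 2 2 * h 1 0 = 0 ->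
  h 1 0 * h 2 1 - h 2 0 * h 1 1 = 0 -> h 2 1 * h 0 2 - h 0 1 * h 2 2 = 0 ->
  h 2 2 * h 0 0 - h 0 2 * h 2 0 = k2 -> h 2 0 * h 0 1 - h 0 0 * h 2 1 = 0 ->
  h 0 1 * h 1 2 - h 1 1 * h 0 2 = 0 -> h 0 2 * h 1 0 - h 1 2 * h 0 0 = 0 ->
  h 0 0 * h 1 1 - h 1 0 * h 0 1 = k3 ->
  with_connection_matrix (fun p11 p12 p13 p21 p22 p23 p31 p32 p33 =>
    curvature_eqs p11 p12 p13 p21 p22 p23 p31 p32 p33 k1 k2 k3).
Proof.
move=> G.
have [a0 a1 a2] := And3 (c_anti3 0) (c_anti3 1) (c_anti3 2).
case: a0 a1 a2 => [a00 a01 a02] [a10 a11 a12] [a20 a21 a22].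
rewrite !G !sum_ord3 /christoffel !c_diag a00 a01 a02 a10 a11 a12 a20 a21 a22.
rewrite /with_connection_matrix /half_trace.
move: (c 1 2 0) (c 1 2 1) (c 1 2 2) (c 2 0 0) (c 2 0 1) (c 2 0 2) (c 0 1 0) (c 0 1 1) (c 0 1 2).
move=> x0 x1 x2 y0 y1 y2 z0 z1 z2 E1 E2 E3 E4 E5 E6 E7 E8 E9.
split; split; lra.
Qed.

Section Diagonal.
Variables (h : 'I_3 -> 'I_3 -> R) (dh : 'I_3 -> 'I_3 -> 'I_3 -> R).
Hypothesis h_diag : forall i j, i != j -> h i j = 0.
Hypothesis dh_sym : forall p i j, dh p i j = dh p j i.
Hypothesis dgauss : derive_gauss_eqs h dh.
Hypothesis codazzi : codazzi_frame_eqs h dh.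

Let offdiag : [/\ h 0 1 = 0, h 1 0 = 0 & h 0 2 = 0] /\ [/\ h 2 0 = 0, h 1 2 = 0 & h 2 1 = 0].
Proof. by do !split; exact: h_diag. Qed.

(** Infinitesimal rigidity: a variation of an invertible 3x3 form that preserves all 2x2 minors to
    first order is zero. Each off-diagonal entry is isolated by one minor. *)
Lemma derive_form_rank3 : h 0 0 * h 1 1 * h 2 2 != 0 -> forall p i j, dh p i j = 0.
Proof.
have [[h01 h10 h02] [h20 h12 h21]] := offdiag.
rewrite !mulf_eq0 !negb_or => /andP[/andP[h0 h1] h2] p.
have E := dgauss p.
have D01 : dh p 0 1 = 0.
  by apply: (mulfI h2); have := E 2 0 2 1; rewrite h01 h02 h21; lra.
have D12 : dh p 1 2 = 0.
  by apply: (mulfI h0); have := E 0 1 0 2; rewrite h12 h02 h10; lra.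
have D20 : dh p 2 0 = 0.
  by apply: (mulfI h1); have := E 1 2 1 0; rewrite h20 h10 h21; lra.
have E01 := E 0 1 0 1; have E02 := E 0 2 0 2; have E12 := E 1 2 1 2.
rewrite h01 h10 in E01; rewrite h02 h20 in E02; rewrite h12 h21 in E12.
have D00 : dh p 0 0 = 0.
  apply: (mulfI h1); apply: (mulfI h2); rewrite !mulr0.
  (* The combination F1 + F2 - F3 leaves 2 h11 h22 times the derivative of h00. *)
  have F1 : h 2 2 * (dh p 0 0 * h 1 1 + h 0 0 * dh p 1 1) = 0 by rewrite (_ : _ + _ = 0) ?mulr0//; lra.
  have F2 : h 1 1 * (dh p 0 0 * h 2 2 + h 0 0 * dh p 2 2) = 0 by rewrite (_ : _ + _ = 0) ?mulr0//; lra.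
  have F3 : h 0 0 * (dh p 1 1 * h 2 2 + h 1 1 * dh p 2 2) = 0 by rewrite (_ : _ + _ = 0) ?mulr0//; lra.
  lra.
have D11 : dh p 1 1 = 0 by apply: (mulfI h0); rewrite D00 in E01; lra.
have D22 : dh p 2 2 = 0 by apply: (mulfI h0); rewrite D00 in E02; lra.
by apply: forall_ord3; apply: forall_ord3; rewrite // dh_sym.
Qed.

Lemma codazzi_rank3 : h 0 0 * h 1 1 * h 2 2 != 0 ->
  with_connection_matrix (fun p11 p12 p13 p21 p22 p23 p31 p32 p33 =>
    codazzi_eqs p11 p12 p13 p21 p22 p23 p31 p32 p33 (h 0 0) (h 1 1) (h 2 2)).
Proof.
move=> /derive_form_rank3 dh0.
have [[h01 h10 h02] [h20 h12 h21]] := offdiag.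
have [a0 a1 a2] := And3 (c_anti3 0) (c_anti3 1) (c_anti3 2).
case: a0 a1 a2 => [a00 a01 a02] [a10 a11 a12] [a20 a21 a22].
have E i j l : \sum_k (c i j k * h k l + christoffel c i l k * h j k
            - christoffel c j l k * h i k) = 0 by rewrite -codazzi !dh0 subrr.
have E012 := E 0 1 2; have E120 := E 1 2 0; have E201 := E 2 0 1.
have E010 := E 0 1 0; have E011 := E 0 1 1; have E121 := E 1 2 1.
have E122 := E 1 2 2; have E202 := E 2 0 2; have E200 := E 2 0 0.
move: E012 E120 E201 E010 E011 E121 E122 E202 E200.
rewrite !sum_ord3 /christoffel !c_diag h01 h10 h02 h20 h12 h21 a00 a01 a02 a10 a11 a12 a20 a21 a22.
rewrite /with_connection_matrix /half_trace.
move: (c 1 2 0) (c 1 2 1) (c 1 2 2) (c 2 0 0) (c 2 0 1) (c 2 0 2) (c 0 1 0) (c 0 1 1) (c 0 1 2).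
move: (h 0 0) (h 1 1) (h 2 2) => u v w x0 x1 x2 y0 y1 y2 z0 z1 z2.
by move=> E012 E120 E201 E010 E011 E121 E122 E202 E200; split; split; lra.
Qed.

(** The form has rank 2 here, and it is h /\ h that has rank 1. Differentiating the minors kills
    only the derivatives of the entries h_i2; the remaining ones are eliminated between Codazzi and
    [D2]. *)
Lemma codazzi_rank1 : h 2 2 = 0 -> h 0 0 * h 1 1 != 0 ->
  with_connection_matrix (fun p11 p12 p13 p21 p22 p23 p31 p32 p33 =>
    [/\ p31 = 0, p32 = 0 & p21 = p12]).
Proof.
move=> h22; rewrite mulf_eq0 negb_or => /andP[h0 h1].
have [[h01 h10 h02] [h20 h12 h21]] := offdiag.
have [a0 a1 a2] := And3 (c_anti3 0) (c_anti3 1) (c_anti3 2).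
case: a0 a1 a2 => [a00 a01 a02] [a10 a11 a12] [a20 a21 a22].
have D22 p : dh p 2 2 = 0.
  by apply: (mulfI h0); have := dgauss p 0 2 0 2; rewrite h02 h20 h22; lra.
have D12 p : dh p 1 2 = 0.
  by apply: (mulfI h0); have := dgauss p 0 1 0 2; rewrite h12 h02 h10; lra.
have D02 p : dh p 0 2 = 0.
  by apply: (mulfI h1); have := dgauss p 1 0 1 2; rewrite h02 h12 h01; lra.
have D20 p : dh p 2 0 = 0 by rewrite dh_sym.
have D21 p : dh p 2 1 = 0 by rewrite dh_sym.
have D2 := dgauss 2 0 1 0 1; rewrite h01 h10 in D2.
have E i j l := codazzi i j l.
have E202 := E 2 0 2; have E212 := E 2 1 2.
have E020 := E 0 2 0; have E121 := E 1 2 1.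
move: E202 E212 E020 E121.
rewrite !sum_ord3 /christoffel !c_diag h01 h10 h02 h20 h12 h21 h22 a00 a01 a02 a10 a11 a12 a20 a21 a22.
rewrite !(D22, D12, D02, D20, D21).
rewrite /with_connection_matrix /half_trace.
move: (c 1 2 0) (c 1 2 1) (c 1 2 2) (c 2 0 0) (c 2 0 1) (c 2 0 2) (c 0 1 0) (c 0 1 1) (c 0 1 2).
move=> x0 x1 x2 y0 y1 y2 z0 z1 z2 E202 E212 E020 E121.
split.
- apply: (mulfI h1); lra.
- apply: (mulfI h0); lra.
(* By Codazzi the logarithmic derivatives of h00 and h11 along e3 are -p12 and p21; by [D2] the
   product h00 h11 has derivative 0 along e3. *)
- apply: (mulfI h0); apply: (mulfI h1).
  have F1 : h 1 1 * (dh 2 0 0) = h 1 1 * (y0 * h 0 0) by congr (_ * _); lra.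
  have F2 : h 0 0 * (dh 2 1 1) = h 0 0 * (- x1 * h 1 1) by congr (_ * _); lra.
  lra.
Qed.

End Diagonal.

End FrameAlgebra.

(** * The model metric Lie algebras *)

Section Models.
Context {R : realType}.
Local Notation V := 'rV[R]_3.
Variables (g : {dot V for idfun}) (br : V -> V -> V).
Hypothesis br_linear : forall a u v w, br (a *: u + v) w = a *: br u w + br v w.
Hypothesis br_anti : forall u v, br u v = - br v u.

Lemma dot_symmetric_bilinear : symmetric_bilinear (g : V -> V -> R).
Proof.
by split=> [a u v w|u v]; [rewrite linearPl|rewrite hermC expr0 mul1r].
Qed.
Let sg := dot_symmetric_bilinear.

Lemma dot_gt0 (u : V) : u != 0 -> 0 < g u u.
Proof. exact: neq0_dnorm_gt0. Qed.

Lemma br_suml (u : 'I_3 -> V) w : br (\sum_i u i) w = \sum_i br (u i) w.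
Proof.
have brD x y : br (x + y) w = br x w + br y w.
  by rewrite -[x]scale1r br_linear !scale1r.
by rewrite !sum_ord3 !brD.
Qed.

Lemma brZl a u w : br (a *: u) w = a *: br u w.
Proof.
have br0 : br 0 w = 0.
  have := br_linear 1 0 0 w; rewrite !scale1r addr0 => br0D.
  by apply: (addrI (br 0 w)); rewrite addr0.
by rewrite -[a *: u]addr0 br_linear br0 addr0.
Qed.

Lemma br_self u : br u u = 0.
Proof.
by apply/eqP; have := br_anti u u => /eqP; rewrite -subr_eq0 opprK -mulr2n -scaler_nat scaler_eq0 pnatr_eq0.
Qed.

Lemma br_sum (x y : 'I_3 -> R) (b : 'I_3 -> V) :
  br (\sum_i x i *: b i) (\sum_i y i *: b i)
  = (x 0 * y 1 - x 1 * y 0) *: br (b 0) (b 1)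
  + (x 1 * y 2 - x 2 * y 1) *: br (b 1) (b 2)
  + (x 2 * y 0 - x 0 * y 2) *: br (b 2) (b 0).
Proof.
rewrite br_suml; under eq_bigr => i _ do rewrite brZl br_anti br_suml.
under eq_bigr => i _ do under eq_bigr => j _ do rewrite brZl.
rewrite !sum_ord3 !br_self !scaler0 (br_anti (b 1) (b 0)) (br_anti (b 2) (b 1)) (br_anti (b 0) (b 2)).
move: (br _ _) (br _ _) (br _ _) => X Y Z.
by apply/rowP => k; rewrite !mxE; ring.
Qed.

Lemma br_comb (x0 x1 x2 y0 y1 y2 : R) (u v w : V) :
  br (x0 *: u + x1 *: v + x2 *: w) (y0 *: u + y1 *: v + y2 *: w)
  = (x0 * y1 - x1 * y0) *: br u v + (x1 * y2 - x2 * y1) *: br v w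
    + (x2 * y0 - x0 * y2) *: br w u.
Proof.
have := br_sum (nth 0 [:: x0; x1; x2]) (nth 0 [:: y0; y1; y2]) (triple u v w).
by rewrite !sum_ord3.
Qed.

Section Basis.
Variables (b : 'I_3 -> V) (ob : orthonormal_basis g b).

Lemma orthonormal_expand x : x = \sum_i g x (b i) *: b i.
Proof.
pose B : 'M[R]_3 := \matrix_i b i.
have BG : B *m (gram g *m B^T) = 1%:M.
  apply/matrixP => i j; rewrite mulmxA [RHS]mxE -ob (bform_gram sg) mxE [RHS]mxE.
  by apply: eq_bigr => k _; rewrite !mxE; congr (_ * _);
    apply: eq_bigr => l _; rewrite !mxE.
have {}BG := mulmx1C BG.
rewrite -[LHS]mulmx1 -BG !mulmxA mulmx_sum_row.
apply: eq_bigr => i _; rewrite rowK; congr (_ *: _).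
rewrite (bform_gram sg) !mxE; apply: eq_bigr => k _.
by rewrite !mxE.
Qed.

Definition coords (x : V) : V := \row_i g x (b i).

Lemma coords_linear : linear coords.
Proof.
by move=> a u v; apply/rowP => i; rewrite !mxE (bformDl sg) (bformZl sg).
Qed.

Lemma coordsD u v : coords (u + v) = coords u + coords v.
Proof. by rewrite -[u]scale1r coords_linear !scale1r. Qed.

Lemma coordsZ a u : coords (a *: u) = a *: coords u.
Proof. by apply/rowP => i; rewrite !mxE (bformZl sg). Qed.

Lemma coords0 : coords 0 = 0.
Proof. by rewrite -(scale0r 0) coordsZ !scale0r. Qed.

Lemma coords_basis i : coords (b i) = 'e_i.
Proof. by apply/rowP => j; rewrite !mxE ob eqxx eq_sym. Qed.

Lemma dot_coords x y : g x y = \sum_i coords x 0 i * coords y 0 i.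
Proof.
rewrite {1}(orthonormal_expand x) (bform_suml sg).
by apply: eq_bigr => i _; rewrite (bformZl sg) !mxE; congr (_ * _); rewrite (bformC sg).
Qed.

(** A bracket is quadratic in its arguments, so the map [s *: coords] absorbs one factor [s] of the
    structure constants, at the price of the metric factor 1 / s^2. The factor may be negative,
    which allows a change of orientation. *)
Lemma isometric_to_model (s : R) (B12 B23 B31 : V) : s != 0 ->
  coords (br (b 0) (b 1)) = s *: B12 -> coords (br (b 1) (b 2)) = s *: B23 ->
  coords (br (b 2) (b 0)) = s *: B31 ->
  isometric_up_to_scaling (@MetricLieAlgebra R V br g)
    (@MetricLieAlgebra R V (bracket3 B12 B23 B31) (euclid3 R)).
Proof.
move=> s0 E12 E23 E31.
pose f0 x := s *: coords x.
have f0_linear : linear f0.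
  by move=> a u v; rewrite /f0 coords_linear scalerDr !scalerA mulrC.
pose fM := GRing.isLinear.Build _ _ _ _ f0 f0_linear.
pose f : {linear V -> V} := HB.pack f0 fM.
pose fi (y : V) : V := s^-1 *: \sum_i y 0 i *: b i.
have fK : cancel f0 fi.
  move=> x; rewrite /fi; under eq_bigr => i _ do rewrite /f0 !mxE -scalerA.
  by rewrite -scaler_sumr -orthonormal_expand scalerA mulVf ?scale1r.
have fiK : cancel fi f0.
  move=> y; rewrite /fi /f0 coordsZ scalerA mulfV// scale1r sum_ord3 !coordsD !coordsZ !coords_basis.
  by rewrite [RHS]row_sum_delta sum_ord3.
have fbr x y : f0 (br x y) = bracket3 B12 B23 B31 (f0 x) (f0 y).
  rewrite /f0 {1}(orthonormal_expand x) {1}(orthonormal_expand y) br_sum.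
  rewrite !coordsD !coordsZ E12 E23 E31 /bracket3.
  by apply/rowP => k; rewrite !mxE; ring.
have fg x y : g x y = (s ^+ 2)^-1 * euclid (f0 x) (f0 y).
  rewrite dot_coords /euclid mulr_sumr.
  by apply: eq_bigr => i _; rewrite /f0 !mxE; field.
exists ((s ^+ 2)^-1), f; split=> //.
- by rewrite invr_gt0 exprn_even_gt0.
- by exists fi.
Qed.


Lemma isometric_so3 (m : R) : m != 0 -> br (b 0) (b 1) = m *: b 2 ->
  br (b 1) (b 2) = m *: b 0 -> br (b 2) (b 0) = m *: b 1 ->
  isometric_up_to_scaling (@MetricLieAlgebra R V br g) (so3 R).
Proof.
by move=> m0 E12 E23 E31; apply: (isometric_to_model m0);
  rewrite ?(E12, E23, E31) coordsZ coords_basis.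
Qed.

Lemma isometric_r'3_0 (t : R) : t != 0 -> br (b 0) (b 1) = t *: b 2 ->
  br (b 1) (b 2) = 0 -> br (b 2) (b 0) = t *: b 1 ->
  isometric_up_to_scaling (@MetricLieAlgebra R V br g) (r'3_0 R).
Proof.
(* The model has [e1, e2] = - e3, so the factor to absorb is -t. *)
move=> t0 E12 E23 E31; have nt0 : - t != 0 by rewrite oppr_eq0.
apply: (isometric_to_model nt0).
- by rewrite E12 coordsZ coords_basis scalerN scaleNr opprK.
- by rewrite E23 coords0 scaler0.
- by rewrite E31 coordsZ coords_basis scalerN scaleNr opprK.
Qed.

Lemma isometric_r3_0_axis (s : R) : s != 0 -> br (b 0) (b 1) = s *: b 1 ->
  br (b 1) (b 2) = 0 -> br (b 2) (b 0) = 0 ->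
  isometric_up_to_scaling (@MetricLieAlgebra R V br g) (r3_0 R).
Proof.
move=> s0 E12 E23 E31; apply: (isometric_to_model s0).
- by rewrite E12 coordsZ coords_basis.
- by rewrite E23 coords0 scaler0.
- by rewrite E31 coords0 scaler0.
Qed.

End Basis.

Lemma isometric_r3_0 (b : 'I_3 -> V) (p q : R) : orthonormal_basis g b ->
  p ^+ 2 + q ^+ 2 != 0 -> br (b 0) (b 1) = p *: b 0 + q *: b 1 ->
  br (b 1) (b 2) = 0 -> br (b 2) (b 0) = 0 ->
  isometric_up_to_scaling (@MetricLieAlgebra R V br g) (r3_0 R).
Proof.
move=> ob pq0 E12 E23 E31.
pose r := Num.sqrt (p ^+ 2 + q ^+ 2).
have r2 : r ^+ 2 = p ^+ 2 + q ^+ 2 by rewrite sqr_sqrtr// addr_ge0 ?sqr_ge0.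
have r0 : r != 0 by rewrite -sqrf_eq0 r2.
have cs1 : (q / r) * (q / r) + (p / r) * (p / r) = 1.
  rewrite (_ : _ + _ = (p ^+ 2 + q ^+ 2) / r ^+ 2); last by field.
  by rewrite r2 divff.
(* The plane of b0, b1 is rotated until its second axis points along [b0, b1]; the determinant of
   the rotation is 1, so [f0, f1] = [b0, b1] = r f1. *)
pose f0 := (q / r) *: b 0 + (- (p / r)) *: b 1 + 0 *: b 2.
pose f1 := (p / r) *: b 0 + (q / r) *: b 1 + 0 *: b 2.
have b2E : b 2 = 0 *: b 0 + 0 *: b 1 + 1 *: b 2 by rewrite !scale0r !add0r scale1r.
have obE i j := ob i j.
have obf : orthonormal_basis g (triple f0 f1 (b 2)).
  apply: orthonormal_triple => //; rewrite /f0 /f1;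
  rewrite !(bformDl sg, bformDr sg, bformZl sg, bformZr sg) !obE /=; first [ring | rewrite -[RHS]cs1; ring].
apply: (isometric_r3_0_axis obf r0); rewrite /triple /=.
- rewrite /f0 br_comb E23 E31 !scaler0 !addr0 E12 mulNr opprK cs1 scale1r /f1.
  by rewrite scale0r addr0 scalerDr !scalerA ![r * _]mulrC !divfK.
- have := br_comb (p / r) (q / r) 0 0 0 1 (b 0) (b 1) (b 2).
  by rewrite -/f1 -b2E E23 E31 !scaler0 !addr0 !mulr0 subr0 scale0r.
- have := br_comb 0 0 1 (q / r) (- (p / r)) 0 (b 0) (b 1) (b 2).
  by rewrite -/f0 -b2E E23 E31 !scaler0 !addr0 !mul0r subr0 scale0r.
Qed.

Lemma isometric_abelian (b : 'I_3 -> V) : orthonormal_basis g b ->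
  br (b 0) (b 1) = 0 -> br (b 1) (b 2) = 0 -> br (b 2) (b 0) = 0 ->
  isometric_up_to_scaling (@MetricLieAlgebra R V br g) (abelian3 g).
Proof.
move=> ob E12 E23 E31; exists 1, idfun; split=> //=.
- move=> x y; rewrite (orthonormal_expand ob x) (orthonormal_expand ob y) br_sum.
  by rewrite E12 E23 E31 !scaler0 !addr0.
- by move=> x y; rewrite mul1r.
Qed.

End Models.

(** * Classification *)

(** The equations P^T v = tau v say that v = (x, y, z) is orthogonal to all brackets, since the rows
    of tau - P^T are the brackets of basis vectors. As P is symmetric of rank at most 1, any nonzero
    row is such an eigenvector; if the diagonal vanishes, then P = 0 and every v works. *)
Lemma curvature_eqs_flat_kernel (R : realFieldType) (p11 p12 p13 p21 p22 p23 p31 p32 p33 : R) :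
  curvature_eqs p11 p12 p13 p21 p22 p23 p31 p32 p33 0 0 0 ->
  exists x y z : R, [|| x != 0, y != 0 | z != 0] /\
  [/\ p11 * x + p21 * y + p31 * z = (p11 + p22 + p33) * x,
      p12 * x + p22 * y + p32 * z = (p11 + p22 + p33) * y &
      p13 * x + p23 * y + p33 * z = (p11 + p22 + p33) * z].
Proof.
move=> /curvature_eqs_flat[[-> -> ->] [[D1 D2 D3] [M1 M2 M3]]].
have [p11_0|p11_0] := eqVneq p11 0; last first.
  by exists p11, p12, p13; rewrite p11_0; split=> //; split; lra.
have [p22_0|p22_0] := eqVneq p22 0; last first.
  by exists p12, p22, p23; rewrite p22_0 orbT; split=> //; split; lra.
have [p33_0|p33_0] := eqVneq p33 0; last first.
  by exists p13, p23, p33; rewrite p33_0 !orbT; split=> //; split; lra.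
rewrite p11_0 p22_0 p33_0 !mul0r in D1 D2 D3 *.
have sq0 (x : R) : 0 = x ^+ 2 -> x = 0 by move=> /esym/eqP; rewrite sqrf_eq0 => /eqP.
rewrite (sq0 _ D1) (sq0 _ D2) (sq0 _ D3).
by exists 1, 0, 0; rewrite oner_neq0; split=> //; split; lra.
Qed.

Section Classification.
Context {R : realType}.
Local Notation V := 'rV[R]_3.
Variables (g : {dot V for idfun}) (br : V -> V -> V).
Hypothesis br_linear : forall a u v w, br (a *: u + v) w = a *: br u w + br v w.
Hypothesis br_anti : forall u v, br u v = - br v u.
Local Notation L := (@MetricLieAlgebra R V br g).
Let sg := dot_symmetric_bilinear g.

Definition structure_constants (b : 'I_3 -> V) i j k : R := g (br (b i) (b j)) (b k).

Lemma structure_constants_anti b i j k :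
  structure_constants b i j k = - structure_constants b j i k.
Proof. by rewrite /structure_constants br_anti -scaleN1r (bformZl sg) mulN1r. Qed.

Lemma br_expand b i j : orthonormal_basis g b ->
  br (b i) (b j) = structure_constants b i j 0 *: b 0
    + structure_constants b i j 1 *: b 1 + structure_constants b i j 2 *: b 2.
Proof. by move=> ob; rewrite [LHS](orthonormal_expand ob) sum_ord3. Qed.

Definition isometric_to_a_model : Prop :=
  (exists ip : {dot 'rV[R]_3 for idfun}, isometric_up_to_scaling L (abelian3 ip)) \/
  isometric_up_to_scaling L (r3_0 R) \/
  isometric_up_to_scaling L (r'3_0 R) \/
  isometric_up_to_scaling L (so3 R).

(* A unit vector n orthogonal to the derived algebra exists; in an orthonormal
   basis starting with n the flatness equations leave a single parameter. *)
Lemma flat_model :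
  (forall b, orthonormal_basis g b -> with_connection_matrix (structure_constants b)
    (fun p11 p12 p13 p21 p22 p23 p31 p32 p33 =>
       curvature_eqs p11 p12 p13 p21 p22 p23 p31 p32 p33 0 0 0)) ->
  isometric_to_a_model.
Proof.
move=> flat.
have [n [n1 nbr]] : exists n : V, g n n = 1 /\ forall x y, g n (br x y) = 0.
  (* Diagonalizing [g] against itself merely produces some orthonormal basis. *)
  have [b [ob _ _]] := exists_diagonal_basis sg sg (@dot_gt0 _ g).
  have [x [y [z [xyz0 [E1 E2 E3]]]]] := curvature_eqs_flat_kernel (flat b ob).
  pose m := x *: b 0 + y *: b 1 + z *: b 2.
  have gm i j : g m (br (b i) (b j)) = x * structure_constants b i j 0
      + y * structure_constants b i j 1 + z * structure_constants b i j 2.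
    by rewrite (bformC sg) !(bformDr sg) !(bformZr sg).
  have m0 : m != 0.
    apply: contraTneq xyz0 => m0.
    have bm w : g m w = 0 by rewrite m0 (bform0l sg).
    have obE i j := ob i j.
    move: (bm (b 0)) (bm (b 1)) (bm (b 2)).
    rewrite !(bformDl sg) !(bformZl sg) !obE /= !mulr0 !mulr1 !addr0 !add0r => -> -> ->.
    by rewrite eqxx.
  have g01 : g m (br (b 0) (b 1)) = 0.
    by rewrite gm; move: E1 E2 E3; rewrite /half_trace; lra.
  have g12 : g m (br (b 1) (b 2)) = 0.
    by rewrite gm; move: E1 E2 E3; rewrite /half_trace; lra.
  have g20 : g m (br (b 2) (b 0)) = 0.
    by rewrite gm; move: E1 E2 E3; rewrite /half_trace; lra.
  have [k [_ gk]] := exists_normalized sg (@dot_gt0 _ g) m0.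
  exists (k *: m); split=> // u v.
  rewrite (orthonormal_expand ob u) (orthonormal_expand ob v) (br_sum br_linear br_anti).
  by rewrite (bformZl sg) !(bformDr sg) !(bformZr sg) g01 g12 g20 !mulr0 !addr0 mulr0.
have [v [v1 /(_ 0)]] := exists_unit_orthogonal sg (@dot_gt0 _ g) (n : 'M[R]_(1, 3)) isT.
rewrite row_id => vn.
have [w [w1 wnv]] := exists_unit_orthogonal sg (@dot_gt0 _ g) (col_mx n v : 'M[R]_(1 + 1, 3)) isT.
have wn : g w n = 0 by rewrite -[RHS](wnv (@lshift 1 1 ord0)) rowKu row_id.
have wv : g w v = 0 by rewrite -[RHS](wnv (@rshift 1 1 ord0)) rowKd row_id.
pose b := triple n v w.
have ob : orthonormal_basis g b by apply: orthonormal_triple; rewrite // (bformC sg).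
have c0 i j : structure_constants b i j 0 = 0 by rewrite /structure_constants (bformC sg) nbr.
have := curvature_eqs_flat (flat b ob).
have := br_expand 0 1 ob; have := br_expand 1 2 ob; have := br_expand 2 0 ob.
rewrite /half_trace !c0 !scale0r !oppr0 !add0r.
set c := structure_constants b.
move: (c 0 1 1) (c 0 1 2) (c 1 2 1) (c 1 2 2) (c 2 0 1) (c 2 0 2).
move=> z1 z2 x1 x2 y1 y2 B20 B12 B01 [[S1 S2 S3] [[D1 D2 D3] [M1 M2 M3]]].
have x10 : x1 = 0 by lra.
have x20 : x2 = 0 by lra.
have z1y2 : z1 = y2 by lra.
rewrite x10 x20 !scale0r addr0 in B12.
(* The lower right 2x2 block of P is symmetric and trace-free with determinant 0. What survives is
   the single rotation parameter z2 of ad n. *)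
have /sum_sqr3_le0[z10 y1z2 _] : z1 ^+ 2 + ((y1 - z2) / 2) ^+ 2 + 0 ^+ 2 <= 0 by lra.
rewrite -z1y2 z10 scale0r addr0 in B20.
rewrite z10 scale0r add0r in B01.
have {}y1z2 : y1 = z2 by lra.
rewrite y1z2 in B20.
have [z20|z20] := eqVneq z2 0.
  left; exists g; apply: (isometric_abelian br_linear br_anti ob) => //.
  - by rewrite B01 z20 scale0r.
  - by rewrite B20 z20 scale0r.
by right; right; left; exact: (isometric_r'3_0 br_linear br_anti ob z20).
Qed.

(** The equations are assumed in every orthonormal basis because two kinds are used: one
    diagonalizing [h] for ranks 2 and 3, and, in the flat case, one adapted to the derived
    algebra. *)
Lemma classification (h : V -> V -> R) : symmetric_bilinear h ->
  (forall b, orthonormal_basis g b ->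
    let c := structure_constants b in let hb := fun i j => h (b i) (b j) in
    exists dh, [/\ forall p i j, dh p i j = dh p j i, gauss_eqs c hb,
      derive_gauss_eqs hb dh & codazzi_frame_eqs c hb dh]) ->
  isometric_to_a_model.
Proof.
move=> sh frames; have [b [ob h_diag h_rank]] := exists_diagonal_basis sg sh (@dot_gt0 _ g).
have [dh [dh_sym gauss dgauss codazzi]] := frames b ob.
have c_anti := structure_constants_anti b.
have [h01 h10] : h (b 0) (b 1) = 0 /\ h (b 1) (b 0) = 0 by split; exact: h_diag.
have [h02 h20] : h (b 0) (b 2) = 0 /\ h (b 2) (b 0) = 0 by split; exact: h_diag.
have [h12 h21] : h (b 1) (b 2) = 0 /\ h (b 2) (b 1) = 0 by split; exact: h_diag.
have curv := gauss_curvature c_anti gauss.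
rewrite /= h01 h10 h02 h20 h12 h21 !mulr0 !mul0r !subr0 in curv.
have {}curv := curv _ _ _ erefl erefl erefl erefl erefl erefl erefl erefl erefl.
have B01 := br_expand 0 1 ob; have B12 := br_expand 1 2 ob; have B20 := br_expand 2 0 ob.
have [h22|h22] := eqVneq (h (b 2) (b 2)) 0; last first.
  have h3 : h (b 0) (b 0) * h (b 1) (b 1) * h (b 2) (b 2) != 0 by rewrite mulf_neq0// h_rank.
  have cod := codazzi_rank3 c_anti h_diag dh_sym dgauss codazzi h3.
  rewrite [h (b 2) (b 2) * _]mulrC in curv.
  have [h11 h22'] := codazzi_eqs_rank3 cod curv h3.
  rewrite h11 h22' in curv h3.
  have k0 : 0 < h (b 0) (b 0) * h (b 0) (b 0).
    by rewrite -expr2 exprn_even_gt0 //=; apply: contraNneq h3 => ->; rewrite !mul0r.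
  have := curvature_eqs_sphere curv k0.
  move: B01 B12 B20; rewrite /half_trace; set c := structure_constants b.
  move: (c 0 1 0) (c 0 1 1) (c 0 1 2) (c 1 2 0) (c 1 2 1) (c 1 2 2) (c 2 0 0) (c 2 0 1) (c 2 0 2).
  move=> z0 z1 z2 x0 x1 x2 y0 y1 y2 B01 B12 B20.
  have oppr0_eq (x : R) : - x = 0 -> x = 0 by move=> /eqP; rewrite oppr_eq0 => /eqP.
  move=> [[/oppr0_eq y00 /oppr0_eq z00 /oppr0_eq z10] [/oppr0_eq x10 /oppr0_eq x20 /oppr0_eq y20] E1 E2 E3].
  rewrite y00 z00 z10 x10 x20 y20 !scale0r !add0r ?addr0 in B01 B12 B20.
  have y1x0 : y1 = x0 by lra.
  have z2x0 : z2 = x0 by lra.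
  rewrite y1x0 in B20; rewrite z2x0 in B01.
  have x00 : x0 != 0 by apply: contraNneq E3 => x00; apply/eqP; lra.
  by do 3!right; exact: (isometric_so3 br_linear br_anti ob x00).
rewrite h22 !mulr0 mul0r in curv.
have [h01'|h01'] := eqVneq (h (b 0) (b 0) * h (b 1) (b 1)) 0; last first.
  have cod := codazzi_rank1 c_anti h_diag dh_sym dgauss codazzi h22 h01'.
  have := cod; rewrite /with_connection_matrix => -[cod1 cod2 cod3].
  have := curvature_eqs_rank1 curv h01' cod1 cod2 cod3.
  move: cod1 cod2 cod3 B01 B12 B20; rewrite /half_trace; set c := structure_constants b.
  move: (c 0 1 0) (c 0 1 1) (c 0 1 2) (c 1 2 0) (c 1 2 1) (c 1 2 2) (c 2 0 0) (c 2 0 1) (c 2 0 2).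
  move=> z0 z1 z2 x0 x1 x2 y0 y1 y2 E1 E2 E3 B01 B12 B20 [[E4 E5 E6 E7] n0].
  have x10 : x1 = 0 by lra.
  have x20 : x2 = 0 by lra.
  have y20 : y2 = 0 by lra.
  have y00 : y0 = 0 by lra.
  have x00 : x0 = 0 by lra.
  have y10 : y1 = 0 by lra.
  have z20 : z2 = 0 by lra.
  rewrite x00 x10 x20 y00 y10 y20 z20 !scale0r !addr0 in B01 B12 B20.
  by rewrite !sqrrN in n0; right; left; exact: (isometric_r3_0 br_linear br_anti ob n0).
apply: flat_model => b' ob'.
have [dh' [_ gauss' _ _]] := frames b' ob'.
have hE u v : h u v = h (b 0) (b 0) * (g u (b 0) * g v (b 0))
    + h (b 1) (b 1) * (g u (b 1) * g v (b 1)).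
  rewrite {1}(orthonormal_expand ob u) {1}(orthonormal_expand ob v) !sum_ord3.
  rewrite !(bformDl sh, bformDr sh, bformZl sh, bformZr sh) h01 h10 h02 h20 h12 h21 h22.
  ring.
(* In diagonal form every 2x2 minor of [h] is h00 h11 times a product of two minors of coordinates,
   so flatness passes to all bases. *)
have minor u v w z : h u v * h w z - h w v * h u z = 0.
  rewrite (hE u v) (hE w z) (hE w v) (hE u z).
  rewrite [LHS](_ : _ = h (b 0) (b 0) * h (b 1) (b 1)
    * ((g u (b 0) * g w (b 1) - g u (b 1) * g w (b 0))
       * (g v (b 0) * g z (b 1) - g v (b 1) * g z (b 0)))); last by ring.
  by rewrite h01' mul0r.
by apply: (gauss_curvature (structure_constants_anti b') gauss'); exact: minor.
Qed.

End Classification.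

(** * Left-invariant fields in a chart *)

Lemma mulg_continuous_at (G : topGroupType) (T : topologicalType) (f h : T -> G) t :
  {for t, continuous f} -> {for t, continuous h} ->
  {for t, continuous (fun y => f y * h y)%g}.
Proof.
move=> cf ch.
apply: (@continuous_comp _ _ _ (fun y => (f y, h y)) (fun z : G * G => z.1 * z.2)%g).
  exact: (cvg_pair cf ch).
exact: mulg_continuous.
Qed.

Section LieChart.
Context {R : realType} {n : nat} (G : lie_group R n).
Local Notation V := 'rV[R]_n.
Local Notation e := (1%g : G).
Let c := chart_at G e.
Local Notation D := (chart_codom c).
Local Notation ci := (chart_inv c).
Local Notation x0 := (c e).

Let c_atlas : atlas G c := chart_at_atlas G e.
Let c_dom : chart_dom c e := chart_at_dom G e.

Lemma unit_codom_x0 : D x0. Proof. by exists e; first exact: c_dom. Qed.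

Lemma unit_codom_open : open D. Proof. exact: chart_codom_open. Qed.

Lemma chart_inv_dom x : D x -> chart_dom c (ci x).
Proof. by case=> p pc <-; rewrite chart_mapK. Qed.

Lemma chart_invK x : D x -> c (ci x) = x.
Proof. by case=> p pc <-; rewrite chart_mapK. Qed.

Lemma near_chart (d : chart R G n) (T : topologicalType) (f : T -> G) t :
  {for t, continuous f} -> chart_dom d (f t) -> \near t, chart_dom d (f t).
Proof.
move=> cf dt; apply: cf; apply: open_nbhs_nbhs; split=> //.
exact: chart_dom_open.
Qed.

Lemma left_continuous (p : G) x : D x -> {for x, continuous (fun y => p * ci y)%g}.
Proof.
by move=> Dx; apply: mulg_continuous_at; [exact: cst_continuous|exact: chart_inv_continuous].
Qed.

Definition chart_mul (z : V * V) : V := c (ci z.1 * ci z.2)%g.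
Definition chart_mul_dom : set (V * V) :=
  [set z | D z.1 /\ D z.2 /\ chart_dom c (ci z.1 * ci z.2)%g].
Local Notation M := chart_mul.
Local Notation Om := chart_mul_dom.

Lemma smooth_chart_mul : smooth_on Om M.
Proof. exact: lg_mul_smooth. Qed.

Lemma mul_continuous z : D z.1 -> D z.2 ->
  {for z, continuous (fun z => ci z.1 * ci z.2)%g}.
Proof.
move=> D1 D2; apply: mulg_continuous_at.
  by apply: (@continuous_comp _ _ _ fst ci); [exact: cvg_fst|exact: chart_inv_continuous].
by apply: (@continuous_comp _ _ _ snd ci); [exact: cvg_snd|exact: chart_inv_continuous].
Qed.

Lemma chart_mul_dom_open : open Om.
Proof.
rewrite openE => z [D1 [D2 Dz]].
have n1 : \near z, D z.1.
  by apply: cvg_fst; apply: open_nbhs_nbhs; split=> //; exact: unit_codom_open.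
have n2 : \near z, D z.2.
  by apply: cvg_snd; apply: open_nbhs_nbhs; split=> //; exact: unit_codom_open.
have n3 := near_chart (mul_continuous D1 D2) Dz.
by apply: filterS3 n1 n2 n3 => ? ? ? ?; split.
Qed.

Lemma chart_mul_dom_x0 x : D x -> Om (x, x0).
Proof.
move=> Dx; split=> //; split; first exact: unit_codom_x0.
by rewrite /= chart_mapK// mulg1; exact: chart_inv_dom.
Qed.

Lemma chart_mul_x0 x : D x -> M (x, x0) = x.
Proof. by move=> Dx; rewrite /M/= chart_mapK// mulg1 chart_invK. Qed.

Lemma chart_inv_mul z : Om z -> ci (M z) = (ci z.1 * ci z.2)%g.
Proof. by case=> _ [_ ?]; rewrite chart_mapK. Qed.

(* The components in c of the left-invariant field with value w at the unit. *)
Definition left_field (w x : V) : V := 'D_((0 : V), w) M (x, x0).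
Local Notation xi := left_field.

Lemma differentiable_chart_mul z : Om z -> differentiable M z.
Proof. exact: smooth_on_differentiable smooth_chart_mul. Qed.

Lemma affine_pairl (y : V) (x v : V) (h : R) :
  (h *: v + x, y) = h *: ((v, 0) : V * V) + (x, y).
Proof. by congr pair; rewrite /= scaler0 add0r. Qed.

Lemma affine_pairr (x : V) (y v : V) (h : R) :
  (x, h *: v + y) = h *: ((0, v) : V * V) + (x, y).
Proof. by congr pair; rewrite /= scaler0 add0r. Qed.

Lemma differentiable_pairl (y x : V) : differentiable (fun x : V => (x, y)) x.
Proof. by apply: differentiable_pair => //; exact: differentiable_cst. Qed.

Lemma differentiable_pairr (x y : V) : differentiable (fun y : V => (x, y)) y.
Proof. by apply: differentiable_pair => //; exact: differentiable_cst. Qed.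

Lemma smooth_left_field w : smooth_on D (xi w).
Proof.
apply: (@smooth_on_sub _ _ _ _ ((fun x : V => (x, x0)) @^-1` Om)); first exact: chart_mul_dom_x0.
apply: (@smooth_on_comp_affine _ _ _ _ _ _ (fun v => (v, 0)) ('D_(0, w) M)).
- by move=> x; exact: differentiable_pairl.
- by move=> x v h; exact: affine_pairl.
- exact: smooth_on_derive smooth_chart_mul.
Qed.

Lemma left_field_linear a u v x : D x -> xi (a *: u + v) x = a *: xi u x + xi v x.
Proof.
move=> Dx; rewrite /xi !deriveE; try exact: differentiable_chart_mul (chart_mul_dom_x0 Dx).
by rewrite -linearP; congr ('d _ _ _); congr pair; rewrite /= scaler0 addr0.
Qed.

Lemma left_fieldE w x : xi w x = 'D_w (fun y => M (x, y)) x0.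
Proof.
by rewrite /xi -(@derive_comp_affine _ _ _ _ (fun y : V => (x, y)) M w)// => h; exact: affine_pairr.
Qed.

Lemma smooth_chart_mull a : smooth_on [set y | Om (a, y)] (fun y => M (a, y)).
Proof.
apply: (@smooth_on_comp_affine _ _ _ _ _ (fun y : V => (a, y)) (fun v => (0, v)) M).
- by move=> x; exact: differentiable_pairr.
- by move=> x v h; exact: affine_pairr.
- exact: smooth_chart_mul.
Qed.


Lemma left_invariant_fieldE w (p : G) :
  left_invariant_field (G := G) w p
  = 'd (fun y => chart_at G p (p * ci y)%g) x0 w.
Proof.
by rewrite /left_invariant_field /tangent_map /left_translation mulg1.
Qed.

Lemma differentiable_left_chart (d : chart R G n) (x y : V) : atlas G d -> D x -> D y ->
  chart_dom d (ci x * ci y)%g -> differentiable (fun y => d (ci x * ci y)%g) y.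
Proof.
move=> ad Dx Dy dxy.
apply: (@differentiable_comp _ _ _ _ (fun y : V => (x, y)) (fun z => d (ci z.1 * ci z.2)%g)).
  exact: differentiable_pairr.
apply: (smooth_on_differentiable (lg_mul_smooth c_atlas c_atlas ad)).
by split.
Qed.

Lemma differentiable_transition (d : chart R G n) (p : G) : atlas G d ->
  chart_dom d p -> chart_dom c p -> differentiable (c \o chart_inv d) (d p).
Proof.
move=> ad dp cp; apply: (smooth_on_differentiable (transition_smooth ad c_atlas)).
by exists p.
Qed.

(** A tangent vector at p is recorded in the chart chosen at p, which differs from the chart at the
    unit. The transition between the two cancels in the composite, leaving a derivative in one fixed
    chart. *)
Lemma tangent_diff_left_field (W : normedModType R) (F : G -> W) (w x : V) :
  D x -> differentiable (F \o ci) x ->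
  tangent_diff G F (p := ci x) (left_invariant_field w (ci x))
  = 'D_(xi w x) (F \o ci) x.
Proof.
move=> Dx dF; rewrite left_invariant_fieldE.
set p := ci x; set d := chart_at G p; rewrite /tangent_diff -/d.
have dp : chart_dom d p := chart_at_dom G p.
have ad : atlas G d := chart_at_atlas G p.
have cp : chart_dom c p := chart_inv_dom Dx.
have Dx0 := unit_codom_x0; have pe : (p * ci x0)%g = p by rewrite chart_mapK// mulg1.
pose psi (y : V) := d (p * ci y)%g; have psi0 : psi x0 = d p by rewrite /psi pe.
have dpsi : differentiable psi x0 by apply: differentiable_left_chart; rewrite // pe.
rewrite -/psi.
have cdi : {for d p, continuous (chart_inv d)}.
  by apply: chart_inv_continuous; exists p.
have Fd : \forall y \near d p, (F \o ci) ((c \o chart_inv d) y) = (F \o chart_inv d) y.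
  have cdp : chart_dom c (chart_inv d (d p)) by rewrite chart_mapK.
  by apply: filterS (near_chart cdi cdp) => y cy; rewrite /= chart_mapK.
have dcd : differentiable (c \o chart_inv d) (d p) by exact: differentiable_transition.
have dFd : differentiable (F \o chart_inv d) (d p).
  have E0 : (c \o chart_inv d) (d p) = x by rewrite /= chart_mapK// chart_invK.
  apply: (near_eq_differentiable Fd).
  apply: (differentiable_comp dcd); rewrite E0; exact: dF.
have dFd' : differentiable (F \o chart_inv d) (psi x0) by rewrite psi0.
have dcomp := differentiable_comp dpsi dFd'.
have := diff_comp dpsi dFd'; rewrite psi0 => /(congr1 (fun f => f w)) /= <-.
rewrite -deriveE// left_fieldE.
have -> : 'D_w ((F \o chart_inv d) \o psi) x0
    = 'D_w ((F \o ci) \o (fun y => M (x, y))) x0.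
  apply: near_eq_derive.
  have n1 : \forall y \near x0, chart_dom d (p * ci y)%g.
    by apply: near_chart; [exact: left_continuous|rewrite pe].
  have n2 : \forall y \near x0, chart_dom c (p * ci y)%g.
    by apply: near_chart; [exact: left_continuous|rewrite pe].
  by apply: filterS2 n1 n2 => y dy cy; rewrite /M /psi /= !chart_mapK.
have dM : differentiable (fun y => M (x, y)) x0.
  by apply: differentiable_left_chart; rewrite // pe.
have dFM : differentiable (F \o ci) (M (x, x0)) by rewrite chart_mul_x0.
rewrite (deriveE _ (differentiable_comp dM dFM)) (deriveE _ dM) (deriveE _ dF).
by have /(congr1 (fun f => f w)) := diff_comp dM dFM; rewrite [in 'd (F \o ci) _]chart_mul_x0.
Qed.

Lemma components_left_field (w x : V) : D x ->
  field_in_chart G c (left_invariant_field w) x = xi w x.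
Proof.
move=> Dx; rewrite /field_in_chart /components.
have ciK : \forall y \near x, y = (c \o ci) y.
  apply: filterS (open_nbhs_nbhs (conj unit_codom_open Dx)) => y Dy.
  by rewrite /= chart_invK.
have dc : differentiable (c \o ci) x by exact: near_eq_differentiable ciK _.
(* Taking components in the chart [c] is the differential of [c], seen as a vector-valued map. *)
rewrite -[LHS]/(tangent_diff G c (p := ci x) (left_invariant_field w (ci x))).
by rewrite tangent_diff_left_field// -(near_eq_derive _ ciK) derive_id.
Qed.

Lemma left_invariant_field_unit (w : V) : left_invariant_field (G := G) w e = w.
Proof.
have Dx0 := unit_codom_x0.
rewrite left_invariant_fieldE.
have ciK : \forall y \near x0, y = c (e * ci y)%g.
  apply: filterS (open_nbhs_nbhs (conj unit_codom_open Dx0)) => y Dy.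
  by rewrite mul1g chart_invK.
have dl : differentiable (fun y => c (e * ci y)%g) x0.
  exact: near_eq_differentiable ciK _.
by apply: etrans (esym (deriveE w dl)) _; rewrite -(near_eq_derive _ ciK) derive_id.
Qed.

Lemma lie_algebra_bracketE (v w : V) :
  lie_algebra_bracket (G := G) v w = 'D_v (xi w) x0 - 'D_w (xi v) x0.
Proof.
have Dx0 := unit_codom_x0.
have dxi (u z : V) :
    'd (field_in_chart G c (left_invariant_field u)) x0 z = 'D_z (xi u) x0.
  have E : \forall y \near x0, xi u y = field_in_chart G c (left_invariant_field u) y.
    apply: filterS (open_nbhs_nbhs (conj unit_codom_open Dx0)) => y Dy.
    by rewrite components_left_field.
  have dx := smooth_on_differentiable (@smooth_left_field u) Dx0.
  have dx' := near_eq_differentiable E dx.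
  by rewrite -(deriveE z dx') (near_eq_derive z E).
rewrite /lie_algebra_bracket /field_bracket !left_invariant_field_unit.
by congr (_ - _); exact: dxi.
Qed.

End LieChart.

Lemma scaler_comb_sub (R : pzRingType) (V : lmodType R) (a : R) (p q r s : V) :
  a *: p + q - (a *: r + s) = a *: (p - r) + (q - s).
Proof. by rewrite scalerBr opprD addrACA. Qed.

(** * Brackets and invariance of the left-invariant fields *)

Section LeftInvariantFields.
#[local] Opaque left_field derive.
Context {R : realType} {n : nat} (G : lie_group R n).
Local Notation V := 'rV[R]_n.
Local Notation c := (chart_at G (1%g : G)).
Local Notation D := (chart_codom c).
Local Notation ci := (chart_inv c).
Local Notation x0 := (c (1%g : G)).
Local Notation M := (chart_mul G).
Local Notation Om := (chart_mul_dom G).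
Local Notation xi := (left_field G).
Let Dx0 : D x0 := unit_codom_x0 G.

Definition right_factors (a : V) : set V := [set y | Om (a, y)].
Local Notation Oml := right_factors.

Definition chart_bracket (v w : V) : V := 'D_v (xi w) x0 - 'D_w (xi v) x0.
Local Notation br := chart_bracket.

Lemma open_right_factors a : open (Oml a).
Proof.
have cont : continuous (fun y : V => (a, y)).
  by move=> y; apply: differentiable_continuous; exact: differentiable_pairr.
exact: (open_comp (fun y _ => cont y) (@chart_mul_dom_open _ _ G)).
Qed.

Lemma nbhs_right_factors a x : Om (a, x) -> nbhs x (Oml a).
Proof. by move=> oax; apply: open_nbhs_nbhs; split=> //; exact: open_right_factors. Qed.

Lemma differentiable_chart_mull a x : Om (a, x) -> differentiable (fun y => M (a, y)) x.
Proof. exact: (smooth_on_differentiable (@smooth_chart_mull _ _ G a)). Qed.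

Let add_sub_cancel (p q s t : R) : s = t -> p + s - (q + t) = p - q.
Proof. by move=> ->; rewrite opprD addrACA subrr addr0. Qed.

(* Associativity m(m(a, x), y) = m(a, m(x, y)), differentiated in y at the unit. *)
Lemma left_field_translate a w x : Om (a, x) ->
  xi w (M (a, x)) = 'D_(xi w x) (fun y => M (a, y)) x.
Proof.
move=> oax; have [Da [Dx _]] := oax.
have oxx0 : Om (x, x0) by exact: chart_mul_dom_x0.
rewrite left_fieldE.
have -> : 'D_w (fun y => M (M (a, x), y)) x0
    = 'D_w ((fun y => M (a, y)) \o (fun y => M (x, y))) x0.
  apply: near_eq_derive.
  apply: filterS (nbhs_right_factors oxx0) => y oxy /=.
  by rewrite /chart_mul /= (chart_inv_mul oax) -/(M (x, y)) (chart_inv_mul oxy) /= mulgA.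
have d2 : differentiable (fun y => M (a, y)) (M (x, x0)).
  rewrite chart_mul_x0; [exact: differentiable_chart_mull|exact: Dx].
rewrite (derive_comp_diff _ (differentiable_chart_mull oxx0) d2) -left_fieldE chart_mul_x0; first by [].
exact: Dx.
Qed.

Lemma left_field_x0 w : xi w x0 = w.
Proof.
rewrite left_fieldE (near_eq_derive (g := id)) ?derive_id//.
apply: filterS (open_nbhs_nbhs (conj (@unit_codom_open _ _ G) Dx0)) => y Dy.
by rewrite /chart_mul /= chart_mapK ?mul1g ?chart_invK//; exact: chart_at_dom.
Qed.

(** This is [left_field_translate] differentiated along v at x = [x0]. Passing to coordinates makes
    [derive_field_derive] applicable, and its two terms separate the bracket part from the symmetric
    second derivative. *)
Let derive_left_field_coord v w a j : D a ->
  ('D_(xi v a) (xi w) a) 0 j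
  = 'D_('D_v (xi w) x0) (fun y => M (a, y) 0 j : R^o) x0
    + 'D_v ('D_w (fun y => M (a, y) 0 j : R^o)) x0.
Proof.
move=> Da; have oa : Oml a x0 := chart_mul_dom_x0 Da.
have dxi u x (Dx : D x) := smooth_on_differentiable (@smooth_left_field _ _ G u) Dx.
have dM := differentiable_chart_mull oa.
have sf : smooth_on (Oml a) (fun y => M (a, y) 0 j : R^o).
  apply: smooth_on_coord; [exact: open_right_factors|exact: smooth_chart_mull].
have E := derive_field_derive v (@open_right_factors a) oa sf (dxi w _ Dx0).
rewrite left_field_x0 in E; apply: etrans _ E.
transitivity ('D_(xi v a) (fun y => xi w y 0 j : R^o) a).
  by apply/esym/derive_coord; apply: diff_derivable; exact: dxi.
transitivity ('D_v ((fun y => xi w y 0 j : R^o) \o (fun y => M (a, y))) x0).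
  have d2 : differentiable (fun y => xi w y 0 j : R^o) (M (a, x0)).
    rewrite chart_mul_x0; last exact: Da.
    exact: (differentiable_comp (dxi _ _ Da) (differentiable_coord _ _ _)).
  by rewrite (derive_comp_diff _ dM d2) -left_fieldE chart_mul_x0.
apply: near_eq_derive.
apply: filterS (nbhs_right_factors oa) => y oay /=.
by rewrite left_field_translate// derive_coord//; exact/diff_derivable/differentiable_chart_mull.
Qed.

(* Differentiate left_field_translate at the unit: the second derivatives of
   m(a, -) cancel by symmetry. *)
Lemma left_field_bracket v w a : D a ->
  'D_(xi v a) (xi w) a - 'D_(xi w a) (xi v) a = xi (br v w) a.
Proof.
move=> Da; have oa : Oml a x0 := chart_mul_dom_x0 Da.
apply/rowP => j.
transitivity (('D_(xi v a) (xi w) a) 0 j - ('D_(xi w a) (xi v) a) 0 j).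
  by rewrite mxE [X in _ + X]mxE.
apply: etrans (congr2 (fun s t => s - t) (derive_left_field_coord v w j Da)
  (derive_left_field_coord w v j Da)) _.
pose f := fun y => M (a, y) 0 j : R^o; rewrite -/f.
have sf : smooth_on (Oml a) f.
  by apply: smooth_on_coord; [exact: open_right_factors|exact: smooth_chart_mull].
have df := smooth_on_differentiable sf oa.
have S : 'D_v ('D_w f) x0 = 'D_w ('D_v f) x0 := schwarz v w (@open_right_factors a) oa (sf 2%N).
have -> : xi (br v w) a 0 j = 'D_(br v w) f x0.
  rewrite left_fieldE; apply/esym/derive_coord; apply: diff_derivable.
  exact: differentiable_chart_mull.
apply: etrans (add_sub_cancel _ _ S) _; apply: esym.
exact: (derive_dirB _ _ df).
Qed.

(** The second derivatives of [f] cancel by symmetry, which leaves the derivative of [f] along the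
    bracket of the two fields. *)
Lemma field_commutator (A : set V) (f : V -> R^o) u v x :
  open A -> A `<=` D -> A x -> smooth_on A f ->
  'D_(xi u x) (fun y => 'D_(xi v y) f y) x - 'D_(xi v x) (fun y => 'D_(xi u y) f y) x
  = 'D_(xi (br u v) x) f x.
Proof.
move=> oA AD Ax sf; have Dx := AD _ Ax.
have dxi w := smooth_on_differentiable (@smooth_left_field _ _ G w) Dx.
have df := smooth_on_differentiable sf Ax.
have S : 'D_(xi u x) ('D_(xi v x) f) x = 'D_(xi v x) ('D_(xi u x) f) x.
  exact: (schwarz _ _ oA Ax (sf 2%N)).
apply: etrans (congr2 (fun s t => s - t) (derive_field_derive (xi u x) oA Ax sf (dxi v))
  (derive_field_derive (xi v x) oA Ax sf (dxi u))) _.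
apply: etrans (add_sub_cancel _ _ S) _; apply: esym.
apply: etrans (congr1 (fun z : V => 'D_z f x) (esym (left_field_bracket u v Dx))) _.
exact: (derive_dirB _ _ df).
Qed.

Lemma bracket_linear a u v w : br (a *: u + v) w = a *: br u w + br v w.
Proof.
rewrite /chart_bracket.
have dxi z := smooth_on_differentiable (@smooth_left_field _ _ G z) Dx0.
have E : 'D_w (xi (a *: u + v)) x0 = 'D_w (fun x => a *: xi u x + xi v x) x0.
  apply: near_eq_derive.
  apply: filterS (open_nbhs_nbhs (conj (@unit_codom_open _ _ G) Dx0)) => y Dy.
  exact: left_field_linear.
have E' : 'D_w (fun x => a *: xi u x + xi v x) x0 = a *: 'D_w (xi u) x0 + 'D_w (xi v) x0.
  have du : derivable (xi u) x0 w := diff_derivable (dxi u).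
  have dv : derivable (xi v) x0 w := diff_derivable (dxi v).
  exact: derive_linear_comb.
apply: etrans (congr2 (fun s t => s - t) (derive_dir_linear a u v (dxi w)) (etrans E E')) _.
exact: scaler_comb_sub.
Qed.

Lemma bracket_anti u v : br u v = - br v u.
Proof. by rewrite /chart_bracket opprB. Qed.

Lemma isometry_left_field (m : nat) (g : riemannian_metric G) (U : set G) (F : G -> 'rV[R]_m) :
  left_invariant g ->
  (forall p (u v : tangent_space R n p), U p ->
     euclid (tangent_diff G F u) (tangent_diff G F v) = g p u v) ->
  forall x (u v : V), D x -> U (ci x) -> differentiable (F \o ci) x ->
  euclid ('D_(xi u x) (F \o ci) x) ('D_(xi v x) (F \o ci) x) = g 1%g u v.
Proof.
move=> gl iso x u v Dx Ux dF.
rewrite -!(tangent_diff_left_field _ Dx dF) iso//.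
(* Invariance speaks of the metric at [ci x * 1]. All tangent spaces being the same space of row
   vectors, the base point can be replaced by an equal one with the vectors fixed. *)
pose X w : V := left_invariant_field (G := G) w (ci x).
have E q : q = ci x -> g q (X u) (X v) = g (ci x) (X u) (X v).
  by move=> ->.
rewrite -(E _ (mulg1 _)); exact: gl.
Qed.

End LeftInvariantFields.

(** * Hypersurfaces *)

Section IsometricImmersion.
Context {R : realType} {T : Type}.
Local Notation V := 'rV[R]_3.
Variables (g : {dot V for idfun}) (br : V -> V -> V).
Hypothesis br_linear : forall a u v w, br (a *: u + v) w = a *: br u w + br v w.
Hypothesis br_anti : forall u v, br u v = - br v u.
Variables (A : set T) (sm : (T -> R) -> Prop) (X : V -> (T -> R) -> T -> R) (x0 : T).
Hypothesis Ax0 : A x0.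
Hypothesis sm_cst : forall a, sm (fun=> a).
Hypothesis smD : forall f h, sm f -> sm h -> sm (fun x => f x + h x).
Hypothesis smM : forall f h, sm f -> sm h -> sm (fun x => f x * h x).
Hypothesis smX : forall v f, sm f -> sm (X v f).
Hypothesis X_eq : forall v f h x, (forall y, A y -> f y = h y) -> A x ->
  X v f x = X v h x.
Hypothesis X_cst : forall v a x, X v (fun=> a) x = 0.
Hypothesis XD : forall v f h x, sm f -> sm h -> A x ->
  X v (fun y => f y + h y) x = X v f x + X v h x.
Hypothesis XM : forall v f h x, sm f -> sm h -> A x ->
  X v (fun y => f y * h y) x = X v f x * h x + f x * X v h x.
Hypothesis X_linear : forall a u v f x, sm f -> A x ->
  X (a *: u + v) f x = a * X u f x + X v f x.
Hypothesis X_comm : forall u v f x, sm f -> A x ->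
  X u (X v f) x - X v (X u f) x = X (br u v) f x.
Variable phi : 'I_4 -> T -> R.
Hypothesis sphi : smv sm phi.
Hypothesis phi_isometric : forall u v x, A x ->
  dot4 (fun a => X u (phi a)) (fun a => X v (phi a)) x = g u v.

Let X0 f x : sm f -> A x -> X 0 f x = 0.
Proof.
move=> sf Ax; have := X_linear 1 0 0 sf Ax; rewrite scaler0 addr0 mul1r => E.
by apply: (addrI (X 0 f x)); rewrite addr0 -E.
Qed.

Let X_comb a0 a1 a2 u v w f x : sm f -> A x ->
  X (a0 *: u + a1 *: v + a2 *: w) f x = a0 * X u f x + a1 * X v f x + a2 * X w f x.
Proof.
move=> sf Ax; rewrite -addrA X_linear// X_linear// -[a2 *: w]addr0 X_linear// X0//.
by rewrite addr0 addrA.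
Qed.

Let X_expand b v f x : orthonormal_basis g b -> sm f -> A x ->
  X v f x = \sum_i g v (b i) * X (b i) f x.
Proof.
by move=> ob sf Ax; rewrite {1}(orthonormal_expand ob v) !sum_ord3 X_comb.
Qed.

Variables (b : 'I_3 -> V) (ob : orthonormal_basis g b).

(** The normal is built once from the fixed basis [b]. All frames [b'] considered later share it, so
    their second forms are the matrices of a single bilinear form. *)
Let N (a : 'I_4) (x : T) : R :=
  cross4 (fun k => X (b 0) (phi k) x) (fun k => X (b 1) (phi k) x)
    (fun k => X (b 2) (phi k) x) a.

Let sN : smv sm N.
Proof.
have smN f : sm f -> sm (fun x => - f x).
  move=> sf; have := smM (sm_cst (-1)) sf.
  by under eq_fun do rewrite mulN1r.
have smB f h : sm f -> sm h -> sm (fun x => f x - h x).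
  by move=> sf sh; apply: smD => //; exact: smN.
have s k i : sm (X (b k) (phi i)) by exact/smX/sphi.
have sd i j k : sm (fun x => det3 (fun l => X (b 0) (phi l) x) (fun l => X (b 1) (phi l) x)
    (fun l => X (b 2) (phi l) x) i j k).
  by apply: smD; [apply: (smB)|]; apply: smM => //; apply: (smB); exact: smM.
by move=> [[|[|[|[|//]]]] ?]; rewrite /N /cross4 /=; try apply: (smN); exact: sd.
Qed.

Let N_unit x : A x -> dot4 N N x = 1.
Proof.
move=> Ax; apply: cross4_unit; rewrite -1?[RHS](ob _ _).
all: try by rewrite -[LHS]/(dot4 (fun a => X _ (phi a)) (fun a => X _ (phi a)) x) phi_isometric// ob.
Qed.

Let N_normal v x : A x -> dot4 (fun a => X v (phi a)) N x = 0.
Proof.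
move=> Ax.
have [n0 n1 n2] := cross4_normal (fun k => X (b 0) (phi k) x) (fun k => X (b 1) (phi k) x)
  (fun k => X (b 2) (phi k) x).
rewrite /dot4; under eq_bigr => a _ do rewrite (X_expand v ob (sphi a) Ax) mulr_suml.
rewrite exchange_big sum_ord3 /=.
have E k : \sum_a g v (b k) * X (b k) (phi a) x * N a x
    = g v (b k) * \sum_a X (b k) (phi a) x * N a x.
  by rewrite mulr_sumr; apply: eq_bigr => a _; rewrite mulrA.
by rewrite !E n0 n1 n2 !mulr0 !addr0.
Qed.

Let hform (u v : V) : R := dot4 (fun a => X u (X v (phi a))) N x0.

Let hform_symmetric : symmetric_bilinear hform.
Proof.
split=> [a u v w|u v].
  rewrite /hform /dot4 mulr_sumr -big_split; apply: eq_bigr => k _ /=.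
  by rewrite X_linear//; [ring|exact/smX/sphi].
apply/eqP; rewrite -subr_eq0 /hform -sumrB.
under eq_bigr => a _ do rewrite -mulrBl (X_comm u v (sphi a) Ax0).
by apply/eqP; exact: N_normal.
Qed.

Lemma isometric_immersion_model : isometric_to_a_model g br.
Proof.
apply: (classification br_linear br_anti hform_symmetric).
move=> b' ob' cs hb.
have comm i j f x : sm f -> A x ->
    X (b' i) (X (b' j) f) x - X (b' j) (X (b' i) f) x = \sum_k cs i j k * X (b' k) f x.
  by move=> sf Ax; rewrite X_comm// (X_expand _ ob' sf Ax).
have orth i j x : A x -> dot4 (Xv (fun i => X (b' i)) i phi) (Xv (fun i => X (b' i)) j phi) x = (i == j)%:R.
  by move=> Ax; rewrite -ob'; exact: phi_isometric.
have normal i x : A x -> dot4 (Xv (fun i => X (b' i)) i phi) N x = 0.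
  by move=> Ax; exact: N_normal.
pose Xb i := X (b' i).
have eqX i := @X_eq (b' i).
exists (fun p i j => Xb p (second_form Xb phi N i j) x0); split.
- move=> p i j; apply: X_eq => // y Ay.
  exact: (second_form_sym comm sphi normal i j Ay).
- move=> i j l m.
  exact: (gauss_equation sm_cst smD smM (fun i => @smX (b' i)) eqX (fun i => @X_cst (b' i))
    (fun i => @XD (b' i)) (fun i => @XM (b' i)) comm sphi orth N_unit normal i j l m Ax0).
- move=> p i j l m.
  exact: (derive_gauss_equation sm_cst smD smM (fun i => @smX (b' i)) eqX (fun i => @X_cst (b' i))
    (fun i => @XD (b' i)) (fun i => @XM (b' i)) comm sphi sN orth N_unit normal p i j l m Ax0).
- move=> i j l.
  exact: (codazzi_equation sm_cst smD smM (fun i => @smX (b' i)) eqX (fun i => @X_cst (b' i))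
    (fun i => @XD (b' i)) (fun i => @XM (b' i)) comm sphi sN orth N_unit normal i j l Ax0).
Qed.

End IsometricImmersion.

Section Hypersurface.
Context {R : realType} (G : lie_group R 3) (g : riemannian_metric G).
Variables (U : set G) (F : G -> 'rV[R]_4).
Local Notation V := 'rV[R]_3.
Local Notation c := (chart_at G (1%g : G)).
Local Notation D := (chart_codom c).
Local Notation ci := (chart_inv c).
Local Notation x0 := (c (1%g : G)).
Local Notation xi := (left_field G).
Local Notation br := (chart_bracket G).
Hypothesis g_left : left_invariant g.
Hypothesis U_open : open U.
Hypothesis U1 : U 1%g.
Hypothesis F_smooth : smooth_map_on G U F.
Hypothesis F_isometric : forall p (u v : tangent_space R 3 p), U p ->
  euclid (tangent_diff G F u) (tangent_diff G F v) = g p u v.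

#[local] Opaque left_field derive.

Definition unit_metric : {dot V for idfun} := g 1%g.
Local Notation g1 := unit_metric.
Let sg : symmetric_bilinear (g1 : V -> V -> R) := dot_symmetric_bilinear g1.

Let A : set V := [set x | D x /\ U (ci x)].

Let oA : open A.
Proof.
rewrite openE => x [Dx Ux].
have n1 : \forall y \near x, D y by apply: open_nbhs_nbhs; split=> //; exact: unit_codom_open.
have n2 : \forall y \near x, U (ci y).
  by apply: (chart_inv_continuous Dx); exact: open_nbhs_nbhs.
by apply: filterS2 n1 n2 => y Dy Uy; split.
Qed.

Let Ax0 : A x0.
Proof. by split; [exact: unit_codom_x0|rewrite chart_mapK//; exact: chart_at_dom]. Qed.

Let AD : A `<=` D. Proof. by move=> x []. Qed.

Let sF : smooth_on A (F \o ci).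
Proof.
apply: smooth_on_sub (F_smooth (chart_at_atlas G 1%g)) => x [[p cp <-] Up].
by exists p => //; split=> //; move: Up; rewrite chart_mapK.
Qed.

Let sm (f : V -> R) : Prop := smooth_on A (f : V -> R^o).

Let X (v : V) (f : V -> R) (x : V) : R := 'D_(xi v x) (f : V -> R^o) x.

Let sm_cst a : sm (fun=> a). Proof. exact: smooth_on_cst. Qed.

Let smD f h : sm f -> sm h -> sm (fun x => f x + h x).
Proof. exact: smooth_onD. Qed.

Let smM f h : sm f -> sm h -> sm (fun x => f x * h x).
Proof. exact: smooth_onM. Qed.

Let smX v f : sm f -> sm (X v f).
Proof.
move=> sf; apply: smooth_on_field_derive => //.
exact: smooth_on_sub AD (smooth_left_field _ _).
Qed.

Let X_eq v f h x : (forall y, A y -> f y = h y) -> A x -> X v f x = X v h x.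
Proof.
move=> fh Ax; apply: near_eq_derive.
by apply: filterS (open_nbhs_nbhs (conj oA Ax)) => y; exact: fh.
Qed.

Let X_cst v a x : X v (fun=> a) x = 0.
Proof. exact: derive_cst. Qed.

Let XD v f h x : sm f -> sm h -> A x -> X v (fun y => f y + h y) x = X v f x + X v h x.
Proof.
move=> sf sh Ax; apply: deriveD; apply: diff_derivable;
  [exact: smooth_on_differentiable sf Ax|exact: smooth_on_differentiable sh Ax].
Qed.

Let XM v f h x : sm f -> sm h -> A x ->
  X v (fun y => f y * h y) x = X v f x * h x + f x * X v h x.
Proof.
move=> sf sh Ax.
have df : derivable (f : V -> R^o) x (xi v x).
  by apply: diff_derivable; exact: smooth_on_differentiable sf Ax.
have dh : derivable (h : V -> R^o) x (xi v x).
  by apply: diff_derivable; exact: smooth_on_differentiable sh Ax.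
by apply: etrans (deriveM df dh) _; rewrite addrC mulrC.
Qed.

Let X_linear a u v f x : sm f -> A x -> X (a *: u + v) f x = a * X u f x + X v f x.
Proof.
move=> sf Ax; rewrite /X (left_field_linear _ _ _ (AD Ax)).
exact: derive_dir_linear (smooth_on_differentiable sf Ax).
Qed.

Let X_comm u v f x : sm f -> A x ->
  X u (X v f) x - X v (X u f) x = X (br u v) f x.
Proof. by move=> sf Ax; exact: field_commutator oA AD Ax sf. Qed.

Let phi (a : 'I_4) (x : V) : R := F (ci x) 0 a.

Let sphi : smv sm phi.
Proof. by move=> a; apply: (smooth_on_coord a oA sF). Qed.

Let phi_isometric u v x : A x -> dot4 (fun a => X u (phi a)) (fun a => X v (phi a)) x = g1 u v.
Proof.
move=> Ax; have dF := smooth_on_differentiable sF Ax.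
rewrite -[RHS](isometry_left_field g_left F_isometric u v (AD Ax) Ax.2 dF).
apply: eq_bigr => a _.
by congr (_ * _); apply: derive_coord; exact: diff_derivable.
Qed.


Lemma hypersurface_model : isometric_to_a_model g1 br.
Proof.
(* Any orthonormal basis will do: it only serves to construct the unit normal. *)
have [b [ob _ _]] := exists_diagonal_basis sg sg (@dot_gt0 _ g1).
exact: (isometric_immersion_model (@bracket_linear _ _ G) (@bracket_anti _ _ G) Ax0 sm_cst smD smM smX
  X_eq X_cst XD XM X_linear X_comm sphi phi_isometric ob).
Qed.

End Hypersurface.

Theorem theorem1p1 (R : realType) (G : lie_group R 3) (g : riemannian_metric G) :
  left_invariant g ->
  locally_isometrically_embeddable g 4 ->
  (exists ip : {dot 'rV[R]_3 for idfun},
     isometric_up_to_scaling (metric_lie_algebra_of g) (abelian3 ip)) \/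
  isometric_up_to_scaling (metric_lie_algebra_of g) (r3_0 R) \/
  isometric_up_to_scaling (metric_lie_algebra_of g) (r'3_0 R) \/
  isometric_up_to_scaling (metric_lie_algebra_of g) (so3 R).
Proof.
move=> g_left [U [F [U_open U1 [F_smooth _ _ _] F_isometric]]].
have := hypersurface_model g_left U_open U1 F_smooth F_isometric.
rewrite /isometric_to_a_model.
have -> : @MetricLieAlgebra R 'rV[R]_3 (chart_bracket G) (unit_metric g) = metric_lie_algebra_of g.
  rewrite /metric_lie_algebra_of; congr MetricLieAlgebra.
  by apply/funext => v; apply/funext => w; rewrite lie_algebra_bracketE.
by [].
Qed.
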